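(* Let $m\ge 4$ be even and let $r\ge1$. For every $2\le d\le 2r$ there is a $d$-polytope whose $(\lfloor \frac d2\rfloor-1)$-skeleton is combinatorially isomorphic to that of an $r$-fold product of $m$-gons.
   Context: The $k$-skeleton of a polytope is the complex of all its faces of dimension at most $k$; two skeleta are combinatorially isomorphic if their face posets are isomorphic. The $r$-fold product of $m$-gons is the $2r$-dimensional polytope $P_m\times\cdots\times P_m$ ($r$ factors), $P_m$ a convex polygon with $m$ vertices. *)

(* Defs.v *)
From mathcomp Require Export all_boot all_order all_algebra.
From mathcomp Require Export boolp classical_sets functions cardinality reals.

Set Implicit Arguments.
Unset Strict Implicit.
Unset Printing Implicit Defensive.

Import Order.TTheory GRing.Theory Num.Theory.

Local Open Scope classical_set_scope.
Local Open Scope ring_scope.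
Local Open Scope card_scope.

Definition convhull (R : realType) (n N : nat) (v : 'I_N -> 'rV[R]_n) :
    set 'rV[R]_n :=
  [set x | exists a : 'I_N -> R,
    [/\ forall i, 0 <= a i, \sum_i a i = 1 & x = \sum_i a i *: v i]].

Definition polytope (R : realType) (n : nat) (P : set 'rV[R]_n) : Prop :=
  exists (N : nat) (v : 'I_N -> 'rV[R]_n), P = convhull v.

Definition affhull (R : realType) (n : nat) (A : set 'rV[R]_n) :
    set 'rV[R]_n :=
  [set x | exists (N : nat) (v : 'I_N -> 'rV[R]_n) (a : 'I_N -> R),
    [/\ forall i, A (v i), \sum_i a i = 1 & x = \sum_i a i *: v i]].

(* The dimension of [A] is that of its affine hull.  This is a relation because
   the empty set, of dimension -1, has no dimension in [nat]. *)
Definition has_dim (R : realType) (n : nat) (A : set 'rV[R]_n) (k : nat) :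
    Prop :=
  exists (p : 'rV[R]_n) (U : {vspace 'rV[R]_n}),
    \dim U = k /\ affhull A = [set x | x - p \in U].

Definition dot (R : realType) (n : nat) (c x : 'rV[R]_n) : R :=
  \sum_(i < n) c 0 i * x 0 i.

(* The functional [c] may be zero, so the empty set and [P] itself are faces. *)
Definition face (R : realType) (n : nat) (P F : set 'rV[R]_n) : Prop :=
  exists (c : 'rV[R]_n) (b : R),
    (forall x, P x -> dot c x <= b) /\ F = P `&` [set x | dot c x = b].

Definition skeleton (R : realType) (n : nat) (k : nat) (P : set 'rV[R]_n) :
    set (set 'rV[R]_n) :=
  [set F | face P F /\ (F = set0 \/ exists2 j : nat, (j <= k)%N & has_dim F j)].

Definition poset_iso (T U : Type) (S : set (set T)) (S' : set (set U)) : Prop :=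
  exists f : set T -> set U, set_bij S S' f /\
    (forall F G, S F -> S G -> (F `<=` G <-> f F `<=` f G)).

Definition polygon (R : realType) (m : nat) (P : set 'rV[R]_2) : Prop :=
  [/\ polytope P, has_dim P 2 & [set v | face P [set v]] #= `I_m].

(* [R^(r * 2)] is identified with [(R^2)^r] through [vec_mx]: the [i]-th row of
   [vec_mx x] is the component of [x] in the [i]-th factor. *)
Definition product_power (R : realType) (r : nat) (P : set 'rV[R]_2) :
    set 'rV[R]_(r * 2) :=
  [set x | forall i : 'I_r, P (row i (vec_mx x))].

Arguments product_power {R} r P.

(* Main.v *)
Require Import Defs.
From mathcomp Require Import zify lra ring.

Set Implicit Arguments.
Unset Strict Implicit.
Unset Printing Implicit Defensive.

Import Order.TTheory GRing.Theory Num.Theory.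

Local Open Scope ring_scope.

(* Following Sanyal and Ziegler, [Q] is a linear projection of a deformed
   product of polygons.  The deformation shifts the odd edges of each polygon
   by a coordinate of the preceding one, without changing the combinatorial
   type.  The normals of the [2 r] facets through a vertex of the deformed
   product are then close to coordinate functionals or to [0], and because [m]
   is even, to which of them depends on the parities of the edges only, hence not
   on the vertex.  Projecting by a Vandermonde matrix, the functionals that factor
   through the projection are the polynomials of degree less than [d], and their
   coefficients on those normals are, up to [O(eps)], their values at the nodes.
   A face of dimension at most [k = d./2 - 1] lies on all facets through a vertex
   except at most [k] of them, and a polynomial of degree [2 k + 1 < d] can have
   double zeros at these [k] nodes, a simple zero at the last node, which is the
   limit of no normal, and be positive at the others, as in the proof that cyclic
   polytopes are neighborly; the perturbation is absorbed by Cramer's rule.  So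
   these faces are preserved strictly.  Conversely a face of [Q] of dimension at
   most [k] pulls back to a face of the deformed product, which cannot have
   larger dimension, as it would properly contain a strictly preserved [k]-face. *)

(** * Faces of convex hulls of finite families *)

Section Dot.
Variables (R : realType) (n : nat).
Implicit Types (c x y : 'rV[R]_n) (a : R).

Lemma dotC c x : dot c x = dot x c.
Proof. by apply: eq_bigr => i _; rewrite mulrC. Qed.

Lemma dot0r c : dot c 0 = 0.
Proof. by rewrite /dot big1 // => i _; rewrite mxE mulr0. Qed.

Lemma dotDr c x y : dot c (x + y) = dot c x + dot c y.
Proof. by rewrite /dot -big_split; apply: eq_bigr => i _; rewrite mxE mulrDr. Qed.

Lemma dotZr c a x : dot c (a *: x) = a * dot c x.
Proof. by rewrite /dot mulr_sumr; apply: eq_bigr => i _; rewrite mxE mulrCA. Qed.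

Lemma dotBr c x y : dot c (x - y) = dot c x - dot c y.
Proof. by rewrite dotDr -scaleN1r dotZr mulN1r. Qed.

Lemma dot_sumr (J : Type) (s : seq J) (P : pred J) c (F : J -> 'rV[R]_n) :
  dot c (\sum_(j <- s | P j) F j) = \sum_(j <- s | P j) dot c (F j).
Proof. by apply: (big_morph (dot c)) => [x y|]; rewrite (dotDr, dot0r). Qed.

Lemma dot0l x : dot 0 x = 0. Proof. by rewrite dotC dot0r. Qed.

Lemma dotDl c c' x : dot (c + c') x = dot c x + dot c' x.
Proof. by rewrite dotC dotDr !(dotC x). Qed.

Lemma dotZl a c x : dot (a *: c) x = a * dot c x.
Proof. by rewrite dotC dotZr dotC. Qed.

Lemma dot_suml (J : Type) (s : seq J) (P : pred J) x (F : J -> 'rV[R]_n) :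
  dot (\sum_(j <- s | P j) F j) x = \sum_(j <- s | P j) dot (F j) x.
Proof. by rewrite dotC dot_sumr; apply: eq_bigr => j _; rewrite dotC. Qed.

Lemma dot_mul c x : (c *m x^T) 0 0 = dot c x.
Proof. by rewrite mxE; apply: eq_bigr => i _; rewrite mxE. Qed.

End Dot.

Lemma dot_mulmx (R : realType) (n d : nat) (c : 'rV[R]_d) (x : 'rV[R]_n)
  (M : 'M[R]_(n, d)) : dot c (x *m M) = dot (c *m M^T) x.
Proof. by rewrite -!dot_mul trmx_mul mulmxA. Qed.

Lemma sum_enum_val (V : nmodType) (J : finType) (F : J -> V) :
  \sum_(i < #|J|) F (enum_val i) = \sum_j F j.
Proof. by rewrite [RHS](reindex (@enum_val J J)) //; exact: onW_bij (enum_val_bij J). Qed.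

Section Hull.
Variables (R : realType) (n : nat) (J : finType) (x : J -> 'rV[R]_n).
Implicit Types (S T : {set J}) (F G : set 'rV[R]_n).

Definition hull S : set 'rV[R]_n := fun y => exists a : J -> R,
  [/\ forall j, 0 <= a j, forall j, j \notin S -> a j = 0, \sum_j a j = 1
    & y = \sum_j a j *: x j].

(** Faces are handled through the index sets of the generators they contain. The bound [b] need not
    be attained, so the empty set is exposed. *)
Definition exposed S := exists (c : 'rV[R]_n) (b : R),
  (forall j, dot c (x j) <= b) /\ (forall j, (dot c (x j) == b) = (j \in S)).

Definition vset F : {set J} := [set j | `[< F (x j) >]]%SET.

Lemma hullE : hull [set: J]%SET = convhull (fun i : 'I_#|J| => x (enum_val i)).
Proof.
apply/seteqP; split => y [a].
  case=> a0 _ a1 ->; exists (fun i => a (enum_val i)); split=> //.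
    by rewrite (sum_enum_val a).
  by rewrite (sum_enum_val (fun j => a j *: x j)).
case=> a0 a1 ->; exists (fun j => a (enum_rank j)); split=> //.
- by move=> j; rewrite inE.
- rewrite -sum_enum_val -a1.
  by apply: eq_bigr => i _; rewrite enum_valK.
- rewrite -[RHS]sum_enum_val.
  by apply: eq_bigr => i _; rewrite enum_valK.
Qed.

Lemma hull_mem S j : j \in S -> hull S (x j).
Proof.
move=> jS; exists (fun i => (i == j)%:R); split.
- by move=> i; rewrite ler0n.
- by move=> i; apply: contraNeq => /eqP; case: eqP => // ->.
- by rewrite (bigD1 j) //= eqxx big1 ?addr0 // => i /negPf->.
- rewrite (bigD1 j) //= eqxx scale1r big1 ?addr0 // => i /negPf->.
  by rewrite scale0r.
Qed.

Lemma hullS S T : S \subset T -> (hull S `<=` hull T)%classic.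
Proof.
move=> ST y [a [a0 aS a1 ->]]; exists a; split=> // j jT.
by apply: aS; apply: contra jT; apply: (fintype.subsetP ST).
Qed.

Lemma dot_hull_le S c b : (forall j, j \in S -> dot c (x j) <= b) ->
  forall y, hull S y -> dot c y <= b.
Proof.
move=> cb y [a [a0 aS a1 ->]].
rewrite dot_sumr -[b]mul1r -a1 mulr_suml; apply: ler_sum => j _.
rewrite dotZr; case: (boolP (j \in S)) => jS; first by rewrite ler_wpM2l ?cb.
by rewrite aS // !mul0r.
Qed.

Lemma hull_exposed_face S c b : (forall j, dot c (x j) <= b) ->
  (forall j, (dot c (x j) == b) = (j \in S)) ->
  hull S = (hull [set: J]%SET `&` [set y | dot c y = b])%classic.
Proof.
move=> cb cS; apply/seteqP; split => y.
  move=> yS; split; first by apply: hullS yS; exact: finset.subsetT.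
  move: yS => [a [a0 aS a1 ->]] /=.
  rewrite dot_sumr -[b]mul1r -a1 mulr_suml; apply: eq_bigr => j _.
  rewrite dotZr; case: (boolP (j \in S)) => jS.
    by move: (jS); rewrite -cS => /eqP ->.
  by rewrite aS // !mul0r.
case=> -[a [a0 _ a1 ->]] /= cy; exists a; split=> // j jS.
have : \sum_j a j * (b - dot c (x j)) = 0.
  under eq_bigr do rewrite mulrBr.
  rewrite sumrB -mulr_suml a1 mul1r -[X in X - _]cy dot_sumr.
  by rewrite -sumrB big1 // => i _; rewrite dotZr subrr.
move/eqP; rewrite psumr_eq0; last first.
  by move=> i _; rewrite mulr_ge0 ?a0 // subr_ge0 cb.
move/allP/(_ j); rewrite mem_index_enum => /(_ isT) /=.
by rewrite mulf_eq0 subr_eq0 [b == _]eq_sym cS (negPf jS) orbF => /eqP.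
Qed.

Lemma exposed_face S : exposed S -> face (hull [set: J]%SET) (hull S).
Proof.
move=> [c [b [cb cS]]]; exists c, b; split; last exact: hull_exposed_face.
by apply: dot_hull_le => j _; exact: cb.
Qed.

Lemma vset_hull S : exposed S -> vset (hull S) = S.
Proof.
move=> [c [b [cb cS]]]; apply/setP => j; rewrite inE; apply/asboolP/idP.
  by rewrite (hull_exposed_face cb cS) => -[_ /= /eqP]; rewrite cS.
exact: hull_mem.
Qed.

Lemma face_exposed F : face (hull [set: J]%SET) F ->
  exposed (vset F) /\ F = hull (vset F).
Proof.
move=> [c [b [cb FE]]].
have cb' j : dot c (x j) <= b by apply/cb/hull_mem; rewrite inE.
have cS j : (dot c (x j) == b) = (j \in vset F).
  rewrite inE FE; apply/eqP/asboolP => [e|[]//]; split=> //.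
  by apply: hull_mem; rewrite inE.
by split; [exists c, b | rewrite (hull_exposed_face cb' cS)].
Qed.

Lemma exposed_set0 : exposed finset.set0.
Proof.
exists 0, 1; split=> j; rewrite dot0l ?ler01 // inE.
by rewrite eq_sym oner_eq0.
Qed.

Lemma hull_set0 : hull finset.set0 = classical_sets.set0.
Proof.
apply/seteqP; split=> // y [a [_ a0 a1 _]].
move: a1; rewrite big1 => [/eqP|j _]; last by rewrite a0 // inE.
by rewrite eq_sym oner_eq0.
Qed.

Definition dirs S j0 : {vspace 'rV[R]_n} :=
  (\sum_(j in S) <[x j - x j0]>)%VS.

Lemma mem_dirs S j0 j : j \in S -> x j - x j0 \in dirs S j0.
Proof.
move=> jS; apply: (subvP (sumv_sup j jS (subvv _))).
exact: memv_line.
Qed.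

Lemma hull_dirs S j0 y : hull S y -> y - x j0 \in dirs S j0.
Proof.
move=> [a [_ aS a1 ->]].
have -> : \sum_j a j *: x j - x j0 = \sum_j a j *: (x j - x j0).
  under [RHS]eq_bigr do rewrite scalerBr.
  by rewrite sumrB -scaler_suml a1 scale1r.
apply: memv_suml => j _; case: (boolP (j \in S)) => jS.
  by rewrite memvZ // mem_dirs.
by rewrite aS // scale0r mem0v.
Qed.

Lemma affhull_fin A (K : finType) (v : K -> 'rV[R]_n) (a : K -> R) :
  (forall k, A (v k)) -> \sum_k a k = 1 -> affhull A (\sum_k a k *: v k).
Proof.
move=> Av a1; exists #|K|, (fun i => v (enum_val i)), (fun i => a (enum_val i)).
split=> //; first by rewrite (sum_enum_val a).
by rewrite (sum_enum_val (fun k => a k *: v k)).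
Qed.

Lemma has_dim_hull S j0 : j0 \in S -> has_dim (hull S) (\dim (dirs S j0)).
Proof.
move=> j0S; exists (x j0), (dirs S j0); split=> //.
apply/seteqP; split=> y /=.
  case=> N [v [a [vS a1 ->]]].
  have -> : \sum_i a i *: v i - x j0 = \sum_i a i *: (v i - x j0).
    under [RHS]eq_bigr do rewrite scalerBr.
    by rewrite sumrB -scaler_suml a1 scale1r.
  by apply: memv_suml => i _; rewrite memvZ // hull_dirs.
move=> /memv_sumP [u uS yE].
have [b bE] : {b : J -> R & forall j, j \in S -> u j = b j *: (x j - x j0)}.
  apply: (@choice J R (fun j t => j \in S -> u j = t *: (x j - x j0))) => j.
  case: (boolP (j \in S)) => [/uS /vlineP[t ->]|_]; last by exists 0.
  by exists t.
(* The weight missing from total 1 is put on [j0]. Outside [S] the weight is 0 and the point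
   defaults to [x j0], so that every point used lies in [hull S]. *)
pose v j := if j \in S then x j else x j0.
pose a j := (if j \in S then b j else 0) + (j == j0)%:R * (1 - \sum_(j in S) b j).
have -> : y = \sum_j a j *: v j.
  rewrite /a; under eq_bigr do rewrite scalerDl.
  rewrite big_split /= [X in _ + X](bigD1 j0) //= eqxx mul1r.
  rewrite [X in _ + (_ + X)]big1 ?addr0; last first.
    by move=> j /negPf->; rewrite mul0r scale0r.
  rewrite /v j0S -[y in LHS](subrK (x j0)) yE.
  rewrite (eq_bigr (fun j => b j *: x j - b j *: x j0)); last first.
    by move=> j jS; rewrite bE // scalerBr.
  rewrite sumrB -scaler_suml scalerBl scale1r -addrA [- _ + _]addrC.
  congr (_ + _); rewrite big_mkcond; apply: eq_bigr => j _.
  by case: (j \in S); rewrite ?scale0r.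
apply: affhull_fin.
  by move=> j; rewrite /v; case: ifP => jS; exact: hull_mem.
rewrite /a big_split /= -mulr_suml [X in X * _](bigD1 j0) //= eqxx.
rewrite [X in (1 + X) * _]big1 => [|j /negPf-> //]; rewrite addr0 mul1r -big_mkcond /=.
by rewrite addrC subrK.
Qed.

(** The functional exposing [S] vanishes on [dirs S j0] but not on the direction towards a generator
    of [T] outside [S]. *)
Lemma dirs_ltn S T j0 : j0 \in S -> exposed S -> S \proper T ->
  (\dim (dirs S j0) < \dim (dirs T j0))%N.
Proof.
move=> j0S [c [b [cb cS]]] /properP [ST [t tT tS]].
have sub : (dirs S j0 <= dirs T j0)%VS.
  apply/subv_sumP => j jS; rewrite -memvE mem_dirs //.
  exact: (fintype.subsetP ST).
rewrite ltn_neqAle dimvS // andbT; apply: contra tS => /eqP dE.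
have : x t - x j0 \in dirs S j0.
  have /eqP -> : dirs S j0 == dirs T j0 by rewrite eqEdim sub dE /=.
  exact: mem_dirs.
move=> /memv_sumP [u uS yE].
have : dot c (x t - x j0) = 0.
  rewrite yE dot_sumr big1 // => j jS; have /vlineP[a ->] := uS j jS.
  rewrite dotZr dotBr; move: jS j0S; rewrite -!cS => /eqP -> /eqP ->.
  by rewrite subrr mulr0.
move: j0S; rewrite -!cS dotBr => /eqP -> /eqP; rewrite subr_eq0.
by [].
Qed.

End Hull.

Lemma has_dim_inj (R : realType) (n : nat) (A : set 'rV[R]_n) (k k' : nat) :
  has_dim A k -> has_dim A k' -> k = k'.
Proof.
have sub (p p' : 'rV[R]_n) (U U' : {vspace 'rV[R]_n}) :
    [set z | z - p \in U]%classic = [set z | z - p' \in U']%classic ->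
    (U <= U')%VS.
  move=> E; apply/subvP => u uU.
  have p1 : p - p' \in U'.
    have : [set z | z - p \in U]%classic p by rewrite /= subrr mem0v.
    by rewrite E.
  have : [set z | z - p \in U]%classic (u + p) by rewrite /= addrK.
  rewrite E /= -addrA => h.
  by rewrite -(addrK (p - p') u) memvB.
move=> [p [U [<- E]]] [p' [U' [<- E']]].
have EE := etrans (esym E) E'.
congr (\dim _); apply/eqP; rewrite eqEsubv (sub _ _ _ _ EE).
by rewrite (sub _ _ _ _ (esym EE)).
Qed.

(** * Configurations with the combinatorics of a product of polygons *)

Section Incidence.
Variable m : nat.
Implicit Types (e j : 'I_m) (b : bool).

(* Edge [e] joins the vertices [e] and [e + 1] modulo [m]; as [m] is even, each
   vertex lies on exactly one edge of either parity. *)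
Definition inc e j := (j == e) || (j == ordS e).

Definition edge j b := if odd j == b then j else ord_pred j.

Lemma inc_edge j b : inc (edge j b) j.
Proof. by rewrite /inc /edge; case: ifP => _; rewrite ?ord_predK eqxx ?orbT. Qed.

Hypotheses (hm : (2 < m)%N) (hme : ~~ odd m).

(** At vertex 0 the predecessor is [m - 1], which is odd because [m] is even. *)
Lemma odd_edge j b : odd (edge j b) = b.
Proof.
rewrite /edge; case: ifP => [/eqP //|/negbT jb] /=.
have -> : ((j + m).-1 %% m)%N = if j == 0 :> nat then m.-1 else j.-1.
  have := ltn_ord j; case: eqP => [->|/eqP j0] jm; first by rewrite modn_small; lia.
  by rewrite (_ : (j + m).-1 = j.-1 + m)%N ?modnDr ?modn_small; lia.
by have := ltn_ord j; case: ifP jb => /eqP j0; case: b => /=; lia.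
Qed.

(** The witness is the other end of the edge of parity [~~ b]; as [m > 2], it is not also an end of
    the edge of parity [b]. *)
Lemma edge_away j b : exists j', inc (edge j (~~ b)) j' && ~~ inc (edge j b) j'.
Proof.
have jm := ltn_ord j.
have S1 (i : 'I_m) : ordS i = (if i.+1 == m then 0 else i.+1)%N :> nat.
  by have := ltn_ord i; rewrite /=; case: eqP => [->|]; rewrite ?modnn // => *; rewrite modn_small; lia.
have P1 (i : 'I_m) : ord_pred i = (if i == 0 :> nat then m.-1 else i.-1)%N :> nat.
  have := ltn_ord i; case: eqP => [i0|/eqP i0] im /=.
    by rewrite i0 modn_small; lia.
  by rewrite (_ : (i + m).-1 = i.-1 + m)%N ?modnDr ?modn_small; lia.
rewrite /inc /edge; case: eqP => [jb|/eqP jb]; case: eqP => [jb'|/eqP jb'].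
- by exists j; move: jb jb'; case: b; case: (odd j).
- exists (ordS j); rewrite eqxx orbT ord_predK /= -!val_eqE.
  by move: (S1 j) (P1 j); rewrite /= => -> ->; case: ifP; case: ifP; lia.
- exists (ord_pred j); rewrite eqxx /= -!val_eqE.
  by move: (S1 j) (P1 j); rewrite /= => -> ->; case: ifP; case: ifP; lia.
- by exists j; move: jb jb'; case: b; case: (odd j).
Qed.

Variable r : nat.
Implicit Types (s t : {ffun 'I_r -> 'I_m}) (A B : {set 'I_r * bool}).

(* A product face through the vertex [s] is encoded by the set [A] of facets
   through [s] that contain it, a facet being a factor and an edge parity. *)
Definition pface s A : {set {ffun 'I_r -> 'I_m}} :=
  [set t : {ffun 'I_r -> 'I_m} | [forall l in A, inc (edge (s l.1) l.2) (t l.1)]]%SET.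

Lemma pfaceP s A t :
  reflect (forall l, l \in A -> inc (edge (s l.1) l.2) (t l.1)) (t \in pface s A).
Proof. by rewrite inE; apply: forall_inP. Qed.

Lemma pface_mem s A : s \in pface s A.
Proof. by apply/pfaceP => l _; exact: inc_edge. Qed.

(** Moving one component along its other edge leaves the facet [l] and no other through [s]: the
    neighbor of a vertex in a simple polytope. *)
Lemma pface_away s l : exists t,
  ~~ inc (edge (s l.1) l.2) (t l.1) /\
  forall l', l' != l -> inc (edge (s l'.1) l'.2) (t l'.1).
Proof.
case: l => i b; have [j' /andP[h1 h2]] := edge_away (s i) b.
exists [ffun i' => if i' == i then j' else s i']; rewrite ffunE eqxx; split=> //.
move=> [i' b'] bb /=; rewrite ffunE; case: eqP => [ii|_]; last exact: inc_edge.
by move: bb; rewrite ii xpair_eqE eqxx /=; move: h1; case: (b); case: (b').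
Qed.

Lemma pface_proper s A B : A \proper B -> pface s B \proper pface s A.
Proof.
move=> /properP[AB [l lB lA]]; apply/properP; split.
  by apply/fintype.subsetP => t /pfaceP h; apply/pfaceP => l' /(fintype.subsetP AB)/h.
have [t [h1 h2]] := pface_away s l; exists t.
  by apply/pfaceP => l' lA'; apply: h2; apply: contraNneq lA => <-.
by apply/negP => /pfaceP/(_ l lB); apply/negP.
Qed.

End Incidence.

Lemma superset_card (T : finType) (A : {set T}) c : (#|A| <= c <= #|T|)%N ->
  exists2 B : {set T}, A \subset B & #|B| = c.
Proof.
move=> /andP[]; elim: c => [|c IH].
  by rewrite leqn0 cards_eq0 => /eqP -> _; exists finset.set0; rewrite ?cards0.
rewrite leq_eqVlt => /orP[/eqP <- _|Ac cT]; first by exists A.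
have [B AB Bc] := IH Ac (ltnW cT).
have [l lB] : exists l, l \notin B.
  apply/existsP; rewrite -negb_forall; apply/negP => /forallP h.
  have BE : B = [set: T]%SET by apply/setP => l; rewrite inE h.
  by move: Bc cT; rewrite BE cardsT => ->; rewrite ltnn.
exists (l |: B)%SET; last by rewrite cardsU1 lB Bc.
exact: fintype.subset_trans AB (finset.subsetUr _ _).
Qed.

Section Configuration.
Variables (R : realType) (m r n d k : nat).
Hypotheses (hm : (2 < m)%N) (hme : ~~ odd m).
Notation I := {ffun 'I_r -> 'I_m}.
Variables (x : I -> 'rV[R]_n) (rho : 'I_r -> 'I_m -> 'rV[R]_n) (beta : 'I_r -> 'I_m -> R).
Variables (delta : I -> 'I_r * bool -> 'rV[R]_n) (Pi : 'M[R]_(n, d)).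

Notation rows s l := (rho l.1 (edge (s l.1) l.2)).
Notation rhs s l := (beta l.1 (edge (s l.1) l.2)).

Hypothesis rho_le : forall i e s, dot (rho i e) (x s) <= beta i e.
Hypothesis rho_eq : forall i e (s : I), (dot (rho i e) (x s) == beta i e) = inc e (s i).
Implicit Types (s t : I) (A B : {set 'I_r * bool}).
Hypothesis dual : forall (s : I) u, u = \sum_l dot (rows s l) u *: delta s l.
Hypothesis cert : forall (s : I) (A : {set 'I_r * bool}), (r * 2 - k <= #|A|)%N ->
  exists (c : 'rV[R]_d) (lam : 'I_r * bool -> R),
    [/\ forall l, l \in A -> 0 < lam l, forall l, l \notin A -> lam l = 0
      & c *m Pi^T = \sum_l lam l *: rows s l].

Let q s := x s *m Pi.

(** Pulled back along [Pi], the exposing functional is a combination of the facet normals at [s].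
    Its coefficient at [l] is nonnegative, as seen at the neighbor of [s] off the facet [l] alone,
    and the face is cut out by the facets with nonzero coefficient. *)
Lemma exposed_pface S s : exposed q S -> s \in S -> exists A, S = pface s A.
Proof.
move=> [c [b [cb cS]]] sS.
have cb' t : dot (c *m Pi^T) (x t) <= b by rewrite -dot_mulmx; exact: cb.
have cS' t : (dot (c *m Pi^T) (x t) == b) = (t \in S).
  by rewrite -dot_mulmx; exact: cS.
move: (c *m Pi^T) cb' cS'; clear c cb cS => c cb cS.
pose lam l := dot c (delta s l).
have cE t : b - dot c (x t) = \sum_l lam l * (rhs s l - dot (rows s l) (x t)).
  move: sS; rewrite -cS => /eqP <-; rewrite -dotBr [X in dot c X](dual s) dot_sumr.
  apply: eq_bigr => l _; rewrite dotZr mulrC /lam; congr (_ * _).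
  by rewrite dotBr; congr (_ - _); apply/eqP; rewrite rho_eq inc_edge.
have lam_ge0 l : 0 <= lam l.
  have [t [h1 h2]] := pface_away hm hme s l.
  have := cE t; rewrite (bigD1 l) //= big1 ?addr0; last first.
    move=> l' /h2; rewrite -(rho_eq l'.1 _ t) => /eqP ->.
    by rewrite subrr mulr0.
  have p : 0 < rhs s l - dot (rows s l) (x t).
    by rewrite subr_gt0 lt_neqAle rho_le rho_eq h1.
  move=> E; rewrite -(pmulr_lge0 _ p) -E subr_ge0; exact: cb.
exists [set l | lam l != 0]%SET; apply/setP => t; rewrite -cS.
rewrite eq_sym -subr_eq0 cE psumr_eq0; last first.
  by move=> l _; rewrite mulr_ge0 ?subr_ge0.
apply/allP/pfaceP => [h l|h l _].
  have := h l (mem_index_enum _); rewrite inE /= mulf_eq0 => /orP[/eqP->|].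
    by rewrite eqxx.
  by rewrite subr_eq0 eq_sym rho_eq.
rewrite /= mulf_eq0 -implyNb; apply/implyP => l0.
by rewrite subr_eq0 eq_sym rho_eq; apply: h; rewrite inE.
Qed.

(** For the certificate, the slack at [t] is a combination of facet slacks with coefficients
    positive exactly on [A], so it vanishes only if [t] lies on all facets of [A]. *)
Lemma pface_exposed s A : (r * 2 - k <= #|A|)%N -> exposed q (pface s A).
Proof.
move=> /cert-/(_ s) [c [lam [lam_gt0 lam0 cE]]].
have lam_ge0 l : 0 <= lam l.
  by case: (boolP (l \in A)) => [/lam_gt0/ltW //|/lam0 ->].
exists c, (\sum_l lam l * rhs s l).
have E t : \sum_l lam l * rhs s l - dot c (q t)
    = \sum_l lam l * (rhs s l - dot (rows s l) (x t)).
  rewrite dot_mulmx cE dot_suml -sumrB; apply: eq_bigr => l _.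
  by rewrite dotZl mulrBr.
split=> t.
  by rewrite -subr_ge0 E; apply: sumr_ge0 => l _; rewrite mulr_ge0 ?subr_ge0.
rewrite eq_sym -subr_eq0 E psumr_eq0; last first.
  by move=> l _; rewrite mulr_ge0 ?subr_ge0.
apply/allP/pfaceP => [h l lA|h l _].
  have := h l (mem_index_enum _); rewrite /= mulf_eq0.
  by rewrite gt_eqF ?lam_gt0 //= subr_eq0 eq_sym rho_eq.
rewrite /= mulf_eq0; case: (boolP (l \in A)) => [/h|/lam0 ->].
  by rewrite -(rho_eq l.1 _ t) subr_eq0 eq_sym orbC => ->.
by rewrite eqxx.
Qed.

Lemma card_rows : #|{: 'I_r * bool}| = (r * 2)%N.
Proof. by rewrite card_prod card_ord card_bool. Qed.

Lemma dim_pface_le s A : (\dim (dirs q (pface s A) s) <= r * 2 - #|A|)%N.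
Proof.
have sub : (dirs q (pface s A) s <= \sum_(l in ~: A) <[delta s l *m Pi]>)%VS.
  apply/subv_sumP => t /pfaceP tA; rewrite -memvE /q -mulmxBl [x t - x s](dual s).
  rewrite mulmx_suml; apply: memv_suml => l _; rewrite -scalemxAl.
  case: (boolP (l \in A)) => [lA|lA].
    rewrite dotBr.
    have /eqP -> : dot (rows s l) (x t) == rhs s l by rewrite rho_eq tA.
    have /eqP -> : dot (rows s l) (x s) == rhs s l by rewrite rho_eq inc_edge.
    by rewrite subrr scale0r mem0v.
  rewrite memvZ //; apply: (subvP (sumv_sup l _ (subvv _))).
    by rewrite inE.
  exact: memv_line.
apply: leq_trans (dimvS sub) _; apply: leq_trans (dimv_leq_sum _ _ _) _.
apply: (@leq_trans (\sum_(l in ~: A) 1)).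
  by apply: leq_sum => l _; rewrite dim_vline leq_b1.
by rewrite sum1_card cardsCs finset.setCK card_rows.
Qed.

(** Adding facets one at a time gives a strictly decreasing chain of faces, and [dirs_ltn] makes the
    dimension drop at each of the [j] steps. *)
Lemma dim_pface_ge s A j : (j <= k)%N -> (j <= r * 2)%N -> #|A| = (r * 2 - j)%N ->
  (j <= \dim (dirs q (pface s A) s))%N.
Proof.
elim: j A => [//|j IH] A jk jr Aj.
have [l lA] : exists l, l \notin A.
  apply/existsP; rewrite -negb_forall; apply/negP => /forallP h.
  have AE : A = [set: 'I_r * bool]%SET by apply/setP => l; rewrite inE h.
  by move: Aj; rewrite AE cardsT card_rows; lia.
have Bj : #|l |: A| = (r * 2 - j)%N by rewrite cardsU1 lA Aj; lia.
have := IH _ (ltnW jk) (ltnW jr) Bj; move/leq_ltn_trans; apply.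
apply: dirs_ltn; first exact: pface_mem.
  by apply: pface_exposed; rewrite Bj; lia.
apply: pface_proper => //; apply/properP; split; first exact: finset.subsetUr.
by exists l => //; rewrite finset.setU11.
Qed.

(** The right-hand side mentions neither [x] nor [Pi], so this is what makes the skeleta of
    different configurations comparable. *)
Lemma skeleton_pface S :
  exposed q S /\ (S = finset.set0 \/ exists2 j : nat, (j <= k)%N & has_dim (hull q S) j)
  <-> S = finset.set0 \/ exists s A, (r * 2 - k <= #|A|)%N /\ S = pface s A.
Proof.
split.
  case=> Sexp [->|[j jk Sj]]; first by left.
  case: (set_0Vmem S) => [->|[s sS]]; [by left|right].
  have [A AE] := exposed_pface Sexp sS.
  exists s, A; split=> //; rewrite leqNgt; apply/negP => Ak.
  have dimS := has_dim_inj Sj (has_dim_hull q sS).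
  (* If [A] were too small, the face would properly contain one cut out by exactly [r * 2 - k]
     facets. The latter is exposed and of dimension at least [k], so the former would have dimension
     above [k]. *)
  have [B AB Bk] : exists2 B : {set 'I_r * bool}, A \subset B & #|B| = (r * 2 - k)%N.
    by apply: superset_card; rewrite card_rows; lia.
  have {}AB : A \proper B by rewrite properEcard AB Bk.
  have kr : (k <= r * 2)%N by lia.
  have := dim_pface_ge s (leqnn k) kr Bk.
  have Bexp : exposed q (pface s B) by apply: pface_exposed; rewrite Bk.
  have := dirs_ltn (pface_mem s B) Bexp (pface_proper hm hme s AB).
  by rewrite -AE -dimS; lia.
case=> [->|[s [A [Ak ->]]]]; first by split; [exact: exposed_set0 | left].
split; first exact: pface_exposed.
right; exists (\dim (dirs q (pface s A) s)).
  by apply: leq_trans (dim_pface_le s A) _; lia.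
exact/has_dim_hull/pface_mem.
Qed.

(** The step from [s0] to its neighbor off the facet [l] is a nonzero multiple of [delta s0 l];
    these dual vectors span the space and [Pi] is onto. *)
Lemma has_dim_full (s0 : I) : row_full Pi -> has_dim (hull q [set: I]%SET) d.
Proof.
move=> Pifull; have := has_dim_hull q (finset.in_setT s0).
suff -> : dirs q [set: I]%SET s0 = fullv by rewrite dimvf /dim /= mul1n.
apply/vspaceP => y; rewrite memvf.
have /submxP[u ->] : (y <= Pi)%MS by apply: submx_full.
rewrite [u](dual s0) mulmx_suml; apply: memv_suml => l _.
rewrite -scalemxAl memvZ //.
have [t [h1 h2]] := pface_away hm hme s0 l.
have E : x t - x s0 = (dot (rows s0 l) (x t) - rhs s0 l) *: delta s0 l.
  rewrite [LHS](dual s0) (bigD1 l) //= big1 ?addr0.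
    rewrite dotBr; congr ((_ - _) *: _); apply/eqP.
    by rewrite rho_eq inc_edge.
  move=> l' /h2; rewrite -(rho_eq l'.1 _ t) dotBr => /eqP ->.
  have /eqP -> : dot (rows s0 l') (x s0) == rhs s0 l' by rewrite rho_eq inc_edge.
  by rewrite subrr scale0r.
have nz : dot (rows s0 l) (x t) - rhs s0 l != 0 by rewrite subr_eq0 rho_eq.
rewrite -[delta s0 l](scalerK nz) -E -scalemxAl memvZ // mulmxBl.
exact: (mem_dirs q s0 (finset.in_setT t)).
Qed.

End Configuration.

(** Inclusion of faces is inclusion of exposed index sets, so the isomorphism sends a face of one
    hull to the face of the other with the same index set. *)
Lemma skeleton_iso (R : realType) (n n' k : nat) (J : finType)
    (x : J -> 'rV[R]_n) (y : J -> 'rV[R]_n') :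
  (forall S : {set J},
    exposed x S /\ (S = finset.set0 \/ exists2 j : nat, (j <= k)%N & has_dim (hull x S) j)
    <-> exposed y S /\
        (S = finset.set0 \/ exists2 j : nat, (j <= k)%N & has_dim (hull y S) j)) ->
  poset_iso (skeleton k (hull x [set: J]%SET)) (skeleton k (hull y [set: J]%SET)).
Proof.
move=> xy.
have skelE p (z : J -> 'rV[R]_p) F : skeleton k (hull z [set: J]%SET) F <->
    F = hull z (vset z F) /\ (exposed z (vset z F) /\ (vset z F = finset.set0 \/
       exists2 j : nat, (j <= k)%N & has_dim (hull z (vset z F)) j)).
  split.
    case=> /face_exposed[F1 F2] F3; do 2!split=> //.
    case: F3 => [F0|]; [left|by rewrite -F2; right].
    by apply/setP => j; rewrite !inE F0; apply/asboolP.
  case=> F1 [F2 F3]; split; first by rewrite F1; exact: exposed_face.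
  case: F3 => [F0|]; [left|by rewrite -F1; right].
  by rewrite F1 F0 hull_set0.
have skel_hull p (z : J -> 'rV[R]_p) S : exposed z S ->
    (S = finset.set0 \/ exists2 j : nat, (j <= k)%N & has_dim (hull z S) j) ->
    skeleton k (hull z [set: J]%SET) (hull z S).
  by move=> S1 S2; apply/skelE; rewrite vset_hull.
have leE p (z : J -> 'rV[R]_p) S T : exposed z S -> exposed z T ->
    (hull z S `<=` hull z T)%classic <-> S \subset T.
  move=> Se Te; split; last exact: hullS.
  move=> ST; rewrite -(vset_hull Te) -(vset_hull Se).
  apply/fintype.subsetP => j; rewrite !finset.inE => /asboolP h.
  by apply/asboolP; exact: ST.
exists (fun F => hull y (vset x F)); split; last first.
  move=> F G /skelE[FE /[dup][[Fx _]] /xy[Fy _]] /skelE[GE /[dup][[Gx _]] /xy[Gy _]].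
  by rewrite [X in (X `<=` _)%classic]FE [X in (_ `<=` X)%classic]GE !leE.
split.
- by move=> F /skelE[FE /xy[F1 F2]]; exact: skel_hull.
- move=> F G; rewrite !in_setE => /skelE[FE /xy[Fy _]] /skelE[GE /xy[Gy _]] E.
  by rewrite FE GE -(vset_hull Fy) -(vset_hull Gy) E.
- move=> G /skelE[GE /xy[G1 G2]]; exists (hull x (vset y G)).
    exact: skel_hull.
  by rewrite vset_hull.
Qed.

(** * Separation in dimension [n] and exposed points in the plane *)

Section Eventually.
Variable R : realType.

(** Validity for all sufficiently small positive parameters. It passes to finite conjunctions, which
    lets one deformation parameter serve all vertices and facet sets. *)
Definition small (Q : R -> Prop) := exists2 e, 0 < e & forall t, 0 < t < e -> Q t.

Lemma small_and (Q Q' : R -> Prop) : small Q -> small Q' -> small (fun t => Q t /\ Q' t).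
Proof.
move=> [e e0 H] [e' e0' H']; exists (Num.min e e'); first by rewrite lt_min e0.
by move=> t; rewrite lt_min => /and3P[t0 t1 t2]; split; [apply: H|apply: H']; rewrite t0.
Qed.

Lemma small_forall (J : finType) (Q : J -> R -> Prop) :
  (forall j, small (Q j)) -> small (fun t => forall j, Q j t).
Proof.
move=> H.
suff [e e0 He] : small (fun t => forall j, j \in enum J -> Q j t).
  by exists e => // t /He h j; apply: h; rewrite mem_enum.
elim: (enum J) => [|j s IH]; first by exists 1.
have [e' e0' He'] := small_and (H j) IH.
exists e' => // t /He' [Hj Hs] i; rewrite inE => /orP[/eqP -> //|]; exact: Hs.
Qed.

Lemma small_ltM (A B : R) : 0 < B -> small (fun t => t * A < B).
Proof.
move=> B0; exists (B / (`|A| + 1)) => [|t /andP[t0]].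
  by rewrite divr_gt0 // ltr_wpDl.
rewrite ltr_pdivlMr ?ltr_wpDl // => h; apply: le_lt_trans h.
by rewrite ler_pM2l // (le_trans (ler_norm _)) // lerDl.
Qed.

Lemma small_ex (Q : R -> Prop) : small Q -> exists2 t, 0 < t & Q t.
Proof. by move=> [e e0 H]; exists (e / 2); [|apply: H]; lra. Qed.

End Eventually.

Section Gordan.
Variables (R : realType) (n : nat).

Lemma exists_between N (lo : nat -> R) (u : R) : (forall i, (i < N)%N -> lo i < u) ->
  exists2 t, t < u & forall i, (i < N)%N -> lo i < t.
Proof.
elim: N => [|N IH] h; first by exists (u - 1) => //; lra.
have [i iN|t tu ht] := IH; first by apply: h; rewrite ltnW.
have hN := h N (leqnn _).
exists (Num.max t ((lo N + u) / 2)); first by rewrite gt_max tu; lra.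
move=> i; rewrite ltnS leq_eqVlt lt_max => /orP[/eqP -> | /ht -> //].
by apply/orP; right; lra.
Qed.

(* Induction on the number of vectors: when the functional found for the first
   [N] fails on the last one, replace each [y i] by the combination of [y i] and
   [y N] which that functional annihilates. *)
Lemma gordan N (y : nat -> 'rV[R]_n) :
  (exists c, forall i, (i < N)%N -> 0 < dot c (y i)) \/
  (exists a : nat -> R, [/\ forall i, 0 <= a i, 0 < \sum_(i < N) a i
                          & \sum_(i < N) a i *: y i = 0]).
Proof.
elim: N y => [|N IH] y; first by left; exists 0.
case: N IH => [|N] IH.
  case: (eqVneq (y 0%N) 0) => [y0|y0]; [right|left].
    by exists (fun=> 1); split=> //; rewrite !big_ord_recl !big_ord0 ?y0 ?scaler0 addr0.
  exists (y 0%N) => -[] // _; rewrite /dot lt_neqAle sumr_ge0 ?andbT; last first.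
    by move=> i _; rewrite -expr2 sqr_ge0.
  rewrite eq_sym psumr_eq0; last by move=> i _; rewrite -expr2 sqr_ge0.
  apply: contra y0 => /allP h; apply/eqP/rowP => i; rewrite mxE; apply/eqP.
  by have := h i (mem_index_enum _); rewrite /= -expr2 sqrf_eq0.
have [[c cy]|] := IH y; last first.
  move=> [a [a0 a1 aE]]; right; exists (fun i => if (i < N.+1)%N then a i else 0).
  split=> [i||]; first by case: ifP.
    rewrite big_ord_recr /= ltnn addr0.
    by under eq_bigr => i _ do rewrite ltn_ord.
  rewrite big_ord_recr /= ltnn scale0r addr0 -[RHS]aE.
  by apply: eq_bigr => i _; rewrite ltn_ord.
pose g := - dot c (y N.+1).
have [g0|g0] := ltP g 0.
  left; exists c => i; rewrite ltnS leq_eqVlt => /orP[/eqP ->|/cy //].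
  by rewrite /g in g0; lra.
have [[c' cz]|] := IH (fun i => g *: y i + dot c (y i) *: y N.+1).
  have {}cz i : (i < N.+1)%N -> 0 < g * dot c' (y i) + dot c (y i) * dot c' (y N.+1).
    by move=> /cz; rewrite dotDr !dotZr.
  (* The functional sought is [c' + t *: c]: each earlier vector bounds [t] below by [lo i], and the
     last one bounds it above. If [g] is 0 there is no upper bound, and [u] is merely some number
     beyond every [lo i]. *)
  left; pose lo i := - dot c' (y i) / dot c (y i).
  pose u := if g == 0 then 1 + \sum_(i < N.+1) `|lo i| else dot c' (y N.+1) / g.
  have [i iN|t tu tlo] := @exists_between N.+1 lo u.
    rewrite /u; case: eqVneq => [_|gn0].
      rewrite (bigD1 (Ordinal iN)) //=.
      have : 0 <= \sum_(j < N.+1 | j != Ordinal iN) `|lo j| by apply: sumr_ge0.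
      by have := ler_norm (lo i); lra.
    have gp : 0 < g by rewrite lt_neqAle eq_sym gn0.
    have cp := cy i iN; rewrite /lo ltr_pdivrMr // mulrAC ltr_pdivlMr //.
    by have := cz i iN; lra.
  exists (c' + t *: c) => i; rewrite dotDl dotZl ltnS leq_eqVlt => /orP[/eqP ->|iN].
    move: tu; rewrite /u; case: eqVneq => [gE _|gn0].
      have := cz 0%N isT; rewrite gE mul0r add0r pmulr_rgt0 ?cy // => h.
      by move: gE; rewrite /g => /eqP; rewrite oppr_eq0 => /eqP ->; rewrite mulr0 addr0.
    have gp : 0 < g by rewrite lt_neqAle eq_sym gn0.
    by rewrite ltr_pdivlMr // /g; lra.
  have := tlo i iN; rewrite /lo ltr_pdivrMr ?cy //; lra.
move=> [a [a0 a1 aE]]; right.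
exists (fun i => if (i < N.+1)%N then a i * g else \sum_(j < N.+1) a j * dot c (y j)).
have S0 : 0 < \sum_(j < N.+1) a j * dot c (y j).
  have ge0 (j : 'I_N.+1) : 0 <= a j * dot c (y j).
    by rewrite mulr_ge0 // ltW // cy.
  rewrite lt_neqAle sumr_ge0 // andbT eq_sym psumr_eq0 //.
  apply: contraL a1 => /allP h; rewrite big1 ?ltxx // => j _.
  by have := h j (mem_index_enum _); rewrite /= mulf_eq0 (gt_eqF (cy _ _)) // orbF => /eqP.
split=> [i||].
- by case: ifP => _; [exact: mulr_ge0 | exact: ltW].
- rewrite big_ord_recr /= ltnn ltr_wpDl // sumr_ge0 // => i _.
  by rewrite ltn_ord mulr_ge0.
rewrite big_ord_recr /= ltnn -[RHS]aE scaler_suml -big_split /=.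
by apply: eq_bigr => i _; rewrite ltn_ord scalerDr !scalerA.
Qed.

Lemma separation N (v : 'I_N -> 'rV[R]_n) z : (0 < N)%N -> ~ convhull v z ->
  exists c, forall i, dot c (v i) < dot c z.
Proof.
case: N v => // N v _ zv.
have [[c ch]|[a [a0 a1 aE]]] := gordan N.+1 (fun i => z - v (inord i)).
  by exists c => i; have := ch i (ltn_ord i); rewrite inord_val dotBr subr_gt0.
case: zv; pose A := \sum_(i < N.+1) a i.
exists (fun i => a i / A); split=> [i||].
- by rewrite divr_ge0 // ltW.
- by rewrite -mulr_suml divff // gt_eqF.
have -> : \sum_(i < N.+1) (a i / A) *: v i = A^-1 *: \sum_(i < N.+1) a i *: v i.
  by rewrite scaler_sumr; apply: eq_bigr => i _; rewrite scalerA mulrC.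
suff -> : \sum_(i < N.+1) a i *: v i = A *: z.
  by rewrite scalerA mulVf ?scale1r // gt_eqF.
apply/eqP; rewrite eq_sym -subr_eq0 /A scaler_suml -sumrB -[X in _ == X]aE; apply/eqP.
by apply: eq_bigr => i _; rewrite inord_val scalerBr.
Qed.

End Gordan.

Lemma convhull_mem (R : realType) (n N : nat) (v : 'I_N -> 'rV[R]_n) i : convhull v (v i).
Proof.
exists (fun j => (j == i)%:R); split.
- by move=> j; rewrite ler0n.
- by rewrite (bigD1 i) //= eqxx big1 ?addr0 // => j /negPf->.
- rewrite (bigD1 i) //= eqxx scale1r big1 ?addr0 // => j /negPf->.
  by rewrite scale0r.
Qed.

Lemma convhull_sub (R : realType) (n N M : nat) (v : 'I_N -> 'rV[R]_n) (w : 'I_M -> 'rV[R]_n) :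
  (forall i, convhull w (v i)) -> (convhull v `<=` convhull w)%classic.
Proof.
move=> vw y [a [a0 a1 ->]].
have [B BP] := choice vw.
exists (fun j => \sum_i a i * B i j); split.
- by move=> j; apply: sumr_ge0 => i _; rewrite mulr_ge0 //; case: (BP i).
- rewrite exchange_big -[RHS]a1; apply: eq_bigr => i _.
  by rewrite -mulr_sumr; case: (BP i) => _ -> _; rewrite mulr1.
- under [RHS]eq_bigr do rewrite scaler_suml.
  rewrite exchange_big; apply: eq_bigr => i _; case: (BP i) => _ _ {1}->.
  by rewrite scaler_sumr; apply: eq_bigr => j _; rewrite scalerA.
Qed.

Lemma hull_ord (R : realType) (n N : nat) (v : 'I_N -> 'rV[R]_n) :
  hull v [set: 'I_N]%SET = convhull v.
Proof.
apply/seteqP; split=> y [a]; first by case=> a0 _ a1 ->; exists a.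
by case=> a0 a1 ->; exists a; split=> // j; rewrite finset.inE.
Qed.

Section Plane.
Variable R : realType.
Implicit Types (p q x y z c : 'rV[R]_2).

Lemma dot2 c x : dot c x = c 0 0 * x 0 0 + c 0 1 * x 0 1.
Proof. by rewrite /dot !big_ord_recl big_ord0 addr0 /=; congr (_ + c _ _ * x _ _); apply: val_inj. Qed.

Definition rv2 (a b : R) : 'rV[R]_2 := \row_i (if i == 0 then a else b).

Lemma rv2_0 a b : rv2 a b 0 0 = a. Proof. by rewrite mxE. Qed.
Lemma rv2_1 a b : rv2 a b 0 1 = b. Proof. by rewrite mxE. Qed.

Lemma rv2P x y : x 0 0 = y 0 0 -> x 0 1 = y 0 1 -> x = y.
Proof.
move=> h0 h1; apply/rowP => -[[|[|//]] i2].
  by rewrite (_ : Ordinal i2 = 0) //; apply: val_inj.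
by rewrite (_ : Ordinal i2 = 1) //; apply: val_inj.
Qed.

(* Lexicographic tie-breaking: tilting [c] slightly exposes a single point. *)
Lemma exposed_point N (v : 'I_N -> 'rV[R]_2) c i : c != 0 ->
  exists i0, dot c (v i) <= dot c (v i0) /\ face (convhull v) [set v i0]%classic.
Proof.
(* [c'] is [c] turned by a right angle, so the two values together determine a point. *)
move=> c0; pose c' := rv2 (- c 0 1) (c 0 0).
have c'E x y : dot c x = dot c y -> dot c' x = dot c' y -> x = y.
  rewrite !dot2 rv2_0 rv2_1 => h h'.
  have nz : c 0 0 ^+ 2 + c 0 1 ^+ 2 != 0.
    rewrite paddr_eq0 ?sqr_ge0 // !sqrf_eq0; apply: contra c0 => /andP[/eqP h0 /eqP h1].
    by apply/eqP/rv2P; rewrite mxE.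
  apply: rv2P; apply: (mulfI nz).
    have e z : (c 0 0 ^+ 2 + c 0 1 ^+ 2) * z 0 0 = c 0 0 * (c 0 0 * z 0 0 + c 0 1 * z 0 1)
      - c 0 1 * (- c 0 1 * z 0 0 + c 0 0 * z 0 1) by ring.
    by rewrite !e h h'.
  have e z : (c 0 0 ^+ 2 + c 0 1 ^+ 2) * z 0 1 = c 0 1 * (c 0 0 * z 0 0 + c 0 1 * z 0 1)
    + c 0 0 * (- c 0 1 * z 0 0 + c 0 0 * z 0 1) by ring.
  by rewrite !e h h'.
pose i1 := [arg max_(j > i) dot c (v j)]%O.
have i1P j : dot c (v j) <= dot c (v i1) by rewrite /i1; case: arg_maxP => // k _ h; exact: h.
pose i0 := [arg max_(j > i1 | dot c (v j) == dot c (v i1)) dot c' (v j)]%O.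
have [i0E i0P] : dot c (v i0) = dot c (v i1) /\
    forall j, dot c (v j) = dot c (v i1) -> dot c' (v j) <= dot c' (v i0).
  rewrite /i0; case: arg_maxP => [|k /eqP h1 h2]; first by rewrite eqxx.
  by split=> // j /eqP; exact: h2.
exists i0; split; first by rewrite i0E.
have [t t0 th] : exists2 t, 0 < t & forall j,
    v j = v i0 \/ dot (c + t *: c') (v j) < dot (c + t *: c') (v i0).
  apply: small_ex; apply: small_forall => j.
  have [h|h] := eqVneq (dot c (v j)) (dot c (v i0)).
    exists 1 => // t /andP[t0 _]; rewrite !dotDl !dotZl h ltrD2l.
    have := i0P j; rewrite -i0E => /(_ h); rewrite le_eqVlt => /orP[/eqP h'|h'].
      by left; exact: c'E.
    by right; rewrite ltr_pM2l.
  have p : 0 < dot c (v i0) - dot c (v j) by rewrite subr_gt0 lt_neqAle h i0E i1P.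
  have [e e0 eh] := small_ltM (dot c' (v j) - dot c' (v i0)) p.
  exists e => // u /eh uh; right; rewrite !dotDl !dotZl; lra.
(* The same point may be listed under several indices. *)
pose S := [set j | v j == v i0]%SET.
have -> : [set v i0]%classic = hull v S.
  apply/seteqP; split => [y ->|y [a [_ aS a1 ->]]].
    by apply: hull_mem; rewrite finset.inE.
  rewrite /= -[RHS]scale1r -a1 scaler_suml; apply: eq_bigr => j _.
  case: (boolP (j \in S)) => [|/aS ->]; last by rewrite !scale0r.
  by rewrite finset.inE => /eqP ->.
rewrite -hull_ord; apply: exposed_face.
exists (c + t *: c'), (dot (c + t *: c') (v i0)); split=> j; have [h|h] := th j.
- by rewrite h.
- exact: ltW.
- by rewrite finset.inE h !eqxx.
- rewrite finset.inE (lt_eqF h); apply/esym/negbTE; apply: contraTneq h => ->.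
  by rewrite ltxx.
Qed.

End Plane.

(** * Cyclic order of the vertices of a polygon *)

Section Polygon.
Variable R : realType.
Implicit Types (p q x y z c : 'rV[R]_2).

Definition edge_data m (v a : 'I_m -> 'rV[R]_2) (b : 'I_m -> R) :=
  forall e j, dot (a e) (v j) <= b e /\ (dot (a e) (v j) == b e) = inc e j.

(** A generator outside the hull of the vertices could be separated from them; [exposed_point] then
    yields a vertex at least as far in that direction, a contradiction. *)
Lemma polygon_vertices m (P : set 'rV[R]_2) : (0 < m)%N -> polygon m P ->
  exists w : 'I_m -> 'rV[R]_2, [/\ P = convhull w, injective w
    & forall j, exists c, forall l, l != j -> dot c (w l) < dot c (w j)].
Proof.
move=> m0 [[N [v PE]] _ /card_set_bijP[f [fP finj fsurj]]].
have [w [winj wP]] : exists w : 'I_m -> 'rV[R]_2, injective w /\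
    forall x, face P [set x]%classic <-> exists j, x = w j.
  have ex (j : 'I_m) : exists x, face P [set x]%classic /\ f x = j :> nat.
    by have [x Px fx] := fsurj j (ltn_ord j); exists x.
  have [w wP] := choice ex.
  exists w; split=> [i j E|x].
    by apply: val_inj; have [_ /= <-] := wP i; have [_ /= <-] := wP j; rewrite E.
  split=> [Px|[j ->]]; last by have [] := wP j.
  have fm : (f x < m)%N by exact: fP.
  exists (Ordinal fm); have [h1 h2] := wP (Ordinal fm).
  by apply: finj; rewrite ?in_setE.
have wface j : face P [set w j]%classic by apply/wP; exists j.
have wexp j : exists c, forall y, P y -> y <> w j -> dot c y < dot c (w j).
  have [c [b [cb E]]] := wface j; exists c => y Py yw.
  have : (P `&` [set x | dot c x = b])%classic (w j) by rewrite -E.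
  case=> _ /= ->; rewrite lt_neqAle cb // andbT; apply/eqP => yb; apply: yw.
  by have : [set w j]%classic y by rewrite E.
have wPmem j : P (w j).
  have [c [b [_ E]]] := wface j.
  by have : [set w j]%classic (w j) by []; rewrite E => -[].
exists w; split=> //; last first.
  move=> j; have [c cP] := wexp j; exists c => l lj; apply: cP => // /winj E.
  by rewrite E eqxx in lj.
rewrite PE; apply/seteqP; split; last by apply: convhull_sub => j; rewrite -PE.
apply: convhull_sub => i; apply: contrapT => /separation-/(_ m0)[c cw].
have c0 : c != 0.
  apply: contraTneq (cw (Ordinal m0)) => ->.
  by rewrite !dot0l ltxx.
have [i0 [ii0 /[!(esym PE)] /wP [j E]]] := exposed_point v i c0.
by have := cw j; rewrite -E ltNge ii0.
Qed.

(** Twice the signed area of the triangle [p], [q], [x], positive in counterclockwise order. *)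
Definition det3 p q x :=
  (q 0 0 - p 0 0) * (x 0 1 - p 0 1) - (q 0 1 - p 0 1) * (x 0 0 - p 0 0).

Lemma det3_edge p q x : det3 p q x =
  dot (rv2 (q 0 1 - p 0 1) (p 0 0 - q 0 0)) p - dot (rv2 (q 0 1 - p 0 1) (p 0 0 - q 0 0)) x.
Proof. rewrite /det3 !dot2 !rv2_0 !rv2_1; ring. Qed.

Lemma det3C p q x : det3 p x q = - det3 p q x.
Proof. rewrite /det3; ring. Qed.

Lemma det3_rot p q x : det3 q x p = det3 p q x.
Proof. rewrite /det3; ring. Qed.

Section Sorting.
Variable vs : seq 'rV[R]_2.
Hypothesis vs_exposed : forall x, x \in vs ->
  exists c, forall y, y \in vs -> y != x -> dot c y < dot c x.

Lemma exposed_not_between x y z t : x \in vs -> y \in vs -> z \in vs ->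
  y != x -> z != x -> 0 <= t <= 1 -> x != (1 - t) *: y + t *: z.
Proof.
move=> xs ys zs yx zx /andP[t0 t1]; have [c cP] := vs_exposed xs.
apply/eqP => /(congr1 (dot c)); rewrite dotDr !dotZr => E.
have hy := cP y ys yx; have hz := cP z zs zx.
by have [t2|t2] := leP t (1 / 2); clear -E hy hz t0 t1 t2; nra.
Qed.

Lemma det3_neq0 x y z : x \in vs -> y \in vs -> z \in vs ->
  x != y -> y != z -> x != z -> det3 x y z != 0.
Proof.
move=> xs ys zs xy yz xz; apply/eqP => D0.
have [g gE] : exists g, z - x = g *: (y - x).
  have : y 0 0 - x 0 0 != 0 \/ y 0 1 - x 0 1 != 0.
    case: (eqVneq (y 0 0) (x 0 0)) => h0; last by left; rewrite subr_eq0.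
    right; rewrite subr_eq0; apply: contraNneq xy => h1.
    by apply/eqP/rv2P.
  move: D0; rewrite /det3 => /eqP; rewrite subr_eq0 => /eqP D0.
  case=> nz.
    exists ((z 0 0 - x 0 0) / (y 0 0 - x 0 0)); apply: rv2P; rewrite !mxE.
      by rewrite divfK.
    by apply: (mulfI nz); rewrite D0; field.
  exists ((z 0 1 - x 0 1) / (y 0 1 - x 0 1)); apply: rv2P; rewrite !mxE.
    by apply: (mulfI nz); rewrite -D0; field.
  by rewrite divfK.
have zE : z = (1 - g) *: x + g *: y.
  by apply/eqP; rewrite -subr_eq0 -(subrr (z - x)) {2}gE; apply/eqP/rv2P; rewrite !mxE; ring.
(* Of three collinear points one lies between the others: [x] for [g < 0], [z] for [0 <= g <= 1],
   [y] for [g > 1]. *)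
have [g0|g0] := ltP g 0.
  have nz : 1 - g != 0 by rewrite gt_eqF; lra.
  have := @exposed_not_between x y z (1 - g)^-1 xs ys zs.
  rewrite (eq_sym y) (eq_sym z) invr_ge0 invf_le1; last by lra.
  have <- : x = (1 - (1 - g)^-1) *: y + (1 - g)^-1 *: z.
    by rewrite zE; apply: rv2P; rewrite !mxE; field.
  rewrite eqxx xy xz => /(_ isT isT) h.
  by have : ~~ true by apply: h; lra.
have [g1|g1] := leP g 1.
  have := @exposed_not_between z x y g zs xs ys xz yz.
  by rewrite g0 g1 -zE eqxx => /(_ isT).
have nz : g != 0 by rewrite gt_eqF; lra.
have := @exposed_not_between y x z g^-1 ys xs zs xy.
rewrite (eq_sym z) yz invr_ge0 invf_le1; last by lra.
have <- : y = (1 - g^-1) *: x + g^-1 *: z.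
  by rewrite zE; apply: rv2P; rewrite !mxE; field.
rewrite eqxx => /(_ isT) h.
  by have : ~~ true by apply: h; lra.
Qed.

(** The other vertices lie strictly on one side of a line through [v0], so their angular order
    around [v0] is transitive. The identity is the linear dependence of the three vectors from [v0],
    evaluated at [c]. *)
Lemma angular_trans v0 x y z : v0 \in vs -> x \in vs -> y \in vs -> z \in vs ->
  x != v0 -> y != v0 -> z != v0 ->
  0 <= det3 v0 x y -> 0 <= det3 v0 y z -> 0 <= det3 v0 x z.
Proof.
move=> v0s xs ys zs x0 y0 z0 xy yz; have [c cP] := vs_exposed v0s.
have hx := cP x xs x0; have hy := cP y ys y0; have hz := cP z zs z0.
have E : (dot c v0 - dot c y) * det3 v0 x z =
    (dot c v0 - dot c x) * det3 v0 y z + (dot c v0 - dot c z) * det3 v0 x y.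
  by rewrite !dot2 /det3; ring.
by rewrite -(pmulr_rge0 _ (_ : 0 < dot c v0 - dot c y)) ?subr_gt0 // E addr_ge0 // mulr_ge0 // subr_ge0 ltW.
Qed.

(** Sorting around [v0] orients the triples through [v0]. If a later triple [x], [y], [z] had the
    wrong orientation, [y] would be a convex combination of [v0], [x], [z], although it is
    exposed. *)
Lemma sorted_chirotope : uniq vs -> exists2 s, perm_eq s vs &
  forall i j l, (i < j < l)%N -> (l < size s)%N -> 0 < det3 s`_i s`_j s`_l.
Proof.
case E : vs => [|v0 s0] /=; first by exists [::].
case/andP=> v0s0 us0.
pose leT x y := 0 <= det3 v0 x y.
have leT_total : total leT.
  by move=> x y; rewrite /leT (det3C v0 x y); case: (leP 0 (det3 v0 x y)) => //=; lra.
pose s1 := sort leT s0.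
have s1P : perm_eq s1 s0 by rewrite perm_sort.
have s1s x : x \in s1 -> x \in vs /\ x != v0.
  rewrite (perm_mem s1P) => xs; rewrite E inE xs orbT; split=> //.
  by apply: contraNneq v0s0 => <-.
have v0vs : v0 \in vs by rewrite E inE eqxx.
have s1u : uniq s1 by rewrite (perm_uniq s1P).
have s1pw : pairwise leT s1.
  rewrite -(@sorted_pairwise_in _ (mem s1)); first exact: sort_sorted.
    move=> y x z /s1s[ys y0] /s1s[xs x0] /s1s[zs z0]; exact: angular_trans.
  exact/allP.
have first_pos i j : (i < j < size s1)%N -> 0 < det3 v0 s1`_i s1`_j.
  move=> /andP[ij jz]; have iz := ltn_trans ij jz.
  have [is1 i0] := s1s _ (mem_nth 0 iz); have [js1 j0] := s1s _ (mem_nth 0 jz).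
  rewrite lt_neqAle eq_sym det3_neq0 //=; first exact: (pairwiseP 0 s1pw).
  - by rewrite eq_sym.
  - by rewrite nth_uniq // ltn_eqF.
  - by rewrite eq_sym.
exists (v0 :: s1); first by rewrite perm_cons.
move=> [|i] [|j] [|l] /andP[]; rewrite ?ltn0 //= !ltnS => ij jl lz.
  by apply: first_pos; rewrite jl.
have jz := ltn_trans jl lz; have iz := ltn_trans ij jz.
have pil := first_pos i l; have pij := first_pos i j; have pjl := first_pos j l.
rewrite ij jz in pij; rewrite jl lz in pjl; rewrite (ltn_trans ij jl) lz in pil.
move: {pij}(pij isT) {pjl}(pjl isT) {pil}(pil isT).
have [xs x0] := s1s _ (mem_nth 0 iz); have [ys y0] := s1s _ (mem_nth 0 jz).
have [zs z0] := s1s _ (mem_nth 0 lz).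
have yx : s1`_i != s1`_j by rewrite nth_uniq // ltn_eqF.
have zy : s1`_l != s1`_j by rewrite nth_uniq // gtn_eqF.
move: (s1`_i) (s1`_j) (s1`_l) xs ys zs x0 y0 z0 yx zy => x y z xs ys zs x0 y0 z0 yx zy pij pjl pil.
rewrite ltNge; apply/negP => neg.
have [c cP] := vs_exposed ys.
have h0 := cP v0 v0vs; rewrite (eq_sym v0) in h0; have {}h0 := h0 y0.
have hx := cP x xs yx; have hz := cP z zs zy.
have : det3 v0 x z * dot c y = - det3 x y z * dot c v0 + det3 v0 y z * dot c x + det3 v0 x y * dot c z.
  by rewrite !dot2 /det3; ring.
have : det3 v0 x z = - det3 x y z + det3 v0 y z + det3 v0 x y by rewrite /det3; ring.
nra.
Qed.

End Sorting.

Lemma polygon_edges m (P : set 'rV[R]_2) : (2 < m)%N -> polygon m P ->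
  exists v a b, P = convhull v /\ @edge_data m v a b.
Proof.
move=> m2 /polygon_vertices[|w [PE winj wexp]]; first by lia.
pose vs := codom w.
have vsu : uniq vs by rewrite map_inj_uniq ?enum_uniq.
have vse x : x \in vs -> exists c, forall y, y \in vs -> y != x -> dot c y < dot c x.
  move=> /codomP[j ->]; have [c cP] := wexp j; exists c => _ /codomP[l ->] lj.
  by apply: cP; apply: contra_neq lj => ->.
have [s sP chi] := sorted_chirotope vse vsu.
have ssz : size s = m by rewrite (perm_size sP) size_codom card_ord.
pose v (j : 'I_m) := s`_j.
(* The normal is the edge vector turned clockwise by a right angle, so the slack of edge [e] at
   [v j] is [det3 (v e) (v (ordS e)) (v j)]. *)
exists v, (fun e => rv2 (v (ordS e) 0 1 - v e 0 1) (v e 0 0 - v (ordS e) 0 0)).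
exists (fun e => dot (rv2 (v (ordS e) 0 1 - v e 0 1) (v e 0 0 - v (ordS e) 0 0)) (v e)).
split.
  rewrite PE; apply/seteqP; split; apply: convhull_sub => j.
    have : w j \in s by rewrite (perm_mem sP) codom_f.
    move=> /(nthP 0)[l]; rewrite ssz => lm <-.
    exact: (convhull_mem v (Ordinal lm)).
  have : v j \in vs by rewrite -(perm_mem sP) mem_nth // ssz.
  by move=> /codomP[l ->]; exact: convhull_mem.
move=> e j; rewrite -subr_ge0 eq_sym -subr_eq0 -det3_edge.
suff H : (~~ inc e j -> 0 < det3 (v e) (v (ordS e)) (v j)) /\
         (inc e j -> det3 (v e) (v (ordS e)) (v j) = 0).
  case: (boolP (inc e j)) H => [h [_ ->]|h [h' _]] //; first by rewrite eqxx.
  by have {}h' := h' isT; rewrite gt_eqF // ltW.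
split; last by rewrite /inc => /orP[] /eqP ->; rewrite /det3; ring.
rewrite /inc negb_or -!val_eqE /= => /andP[je jS].
have em := ltn_ord e; have jm := ltn_ord j.
(* The triple is rotated cyclically until its indices increase; the closing edge [m - 1] is a
   separate case. *)
have [eS|eS] := eqVneq e.+1 m.
  have e0 : (e.+1 %% m)%N = 0%N by rewrite eS modnn.
  rewrite /v /= -det3_rot e0; apply: chi; rewrite ?ssz //.
  by rewrite e0 in jS; lia.
have e1 : (e.+1 %% m)%N = e.+1 by rewrite modn_small; lia.
rewrite /v /= e1; rewrite e1 in jS.
have [ej|ej] := ltnP e j; first by apply: chi; rewrite ?ssz //; lia.
by rewrite -det3_rot -det3_rot; apply: chi; rewrite ?ssz; lia.
Qed.

End Polygon.

(** * Products of a polygon *)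

Lemma dual_family (R : realType) (n : nat) (K : finType) (g : K -> 'rV[R]_n) :
  (forall u, (forall l, dot (g l) u = 0) -> u = 0) ->
  exists delta : K -> 'rV[R]_n, forall u, u = \sum_l dot (g l) u *: delta l.
Proof.
move=> g_inj; pose M := \matrix_(j < n, i < #|K|) g (enum_val i) 0 j.
have ME u i : (u *m M) 0 i = dot (g (enum_val i)) u.
  by rewrite mxE; apply: eq_bigr => j _; rewrite mxE mulrC.
have /row_freeP[B MB] : row_free M.
  apply: inj_row_free => u uM; apply: g_inj => l.
  by rewrite -(enum_rankK l) -ME uM mxE.
exists (fun l => row (enum_rank l) B) => u.
rewrite -{1}[u]mulmx1 -MB mulmxA mulmx_sum_row -[RHS]sum_enum_val.
by apply: eq_bigr => i _; rewrite enum_valK ME.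
Qed.

Lemma dot_mxvec (R : realType) (r n : nat) (A B : 'M[R]_(r, n)) :
  dot (mxvec A) (mxvec B) = \sum_i dot (row i A) (row i B).
Proof.
rewrite /dot pair_big /= (reindex _ (curry_mxvec_bij r n)) /=.
by apply: eq_bigr => -[i j] _ /=; rewrite !mxvecE !mxE.
Qed.

Section Edges.
Variables (R : realType) (m : nat) (v a : 'I_m -> 'rV[R]_2) (b : 'I_m -> R).
Hypotheses (hm : (2 < m)%N) (hme : ~~ odd m) (hv : edge_data v a b).

(** The vector runs from [v j] to the other end of the edge of parity [~~ c], suitably scaled. *)
Lemma edge_direction j c : exists w, dot (a (edge j c)) w = 1 /\ dot (a (edge j (~~ c))) w = 0.
Proof.
have [j' /andP[h1 h2]] := edge_away hm hme j c.
have [_ e1] := hv (edge j (~~ c)) j'; have [_ e2] := hv (edge j c) j'.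
have [_ e3] := hv (edge j (~~ c)) j; have [_ e4] := hv (edge j c) j.
have nz : dot (a (edge j c)) (v j' - v j) != 0.
  rewrite dotBr subr_eq0; apply: contra h2 => /eqP E.
  by rewrite -e2 E e4 inc_edge.
exists ((dot (a (edge j c)) (v j' - v j))^-1 *: (v j' - v j)); rewrite !dotZr.
rewrite mulVf //; split=> //; move: e1 e3; rewrite !dotBr inc_edge h1 => /eqP -> /eqP ->.
by rewrite subrr mulr0.
Qed.

Lemma edges_nondegenerate j u : (forall c, dot (a (edge j c)) u = 0) -> u = 0.
Proof.
move=> ua; have [w [w1 w0]] := edge_direction j true; have [w' [w1' w0']] := edge_direction j false.
have := ua true; have := ua false; move: w1 w0 w1' w0'; rewrite /= !dot2.
set p := a (edge j true); set q := a (edge j false) => E1 E2 E3 E4 E5 E6.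
(* The determinant of the normals times that of the directions is the determinant of their matrix of
   pairings, here the identity. Cramer's rule then gives [u = 0]. *)
have D : (p 0 0 * q 0 1 - p 0 1 * q 0 0) * (w 0 0 * w' 0 1 - w 0 1 * w' 0 0) = 1.
  have -> : (p 0 0 * q 0 1 - p 0 1 * q 0 0) * (w 0 0 * w' 0 1 - w 0 1 * w' 0 0) =
    (p 0 0 * w 0 0 + p 0 1 * w 0 1) * (q 0 0 * w' 0 0 + q 0 1 * w' 0 1) -
    (q 0 0 * w 0 0 + q 0 1 * w 0 1) * (p 0 0 * w' 0 0 + p 0 1 * w' 0 1) by ring.
  by rewrite E1 E2 E3 E4; ring.
have nz : p 0 0 * q 0 1 - p 0 1 * q 0 0 != 0.
  by apply: contra_eq_neq D => ->; rewrite mul0r eq_sym oner_eq0.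
apply: rv2P; rewrite mxE; apply: (mulfI nz); rewrite mulr0.
  have -> : (p 0 0 * q 0 1 - p 0 1 * q 0 0) * u 0 0 =
   q 0 1 * (p 0 0 * u 0 0 + p 0 1 * u 0 1) - p 0 1 * (q 0 0 * u 0 0 + q 0 1 * u 0 1) by ring.
  by rewrite E5 E6 !mulr0 subrr.
have -> : (p 0 0 * q 0 1 - p 0 1 * q 0 0) * u 0 1 =
  p 0 0 * (q 0 0 * u 0 0 + q 0 1 * u 0 1) - q 0 0 * (p 0 0 * u 0 0 + p 0 1 * u 0 1) by ring.
by rewrite E5 E6 !mulr0 subrr.
Qed.

Lemma incP (e j : 'I_m) : inc e j -> e = edge j (odd e).
Proof.
rewrite /inc /edge => /orP[] /eqP ->; first by rewrite eqxx.
have -> : (odd (ordS e) == odd e) = false.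
  have := ltn_ord e; rewrite /= => em; have [eS|eS] := eqVneq e.+1 m.
    by rewrite eS modnn; lia.
  by rewrite modn_small; lia.
by rewrite ordSK.
Qed.

End Edges.

Section Product.
Variables (R : realType) (m r : nat) (v a : 'I_m -> 'rV[R]_2) (b : 'I_m -> R).
Hypotheses (hm : (2 < m)%N) (hme : ~~ odd m) (hv : edge_data v a b).
Notation I := {ffun 'I_r -> 'I_m}.

Lemma sum_prod_marginal (c : 'I_r -> 'I_m -> R) i (h : 'I_m -> R) :
  (forall i', \sum_j c i' j = 1) ->
  \sum_(s : I) (\prod_i' c i' (s i')) * h (s i) = \sum_j c i j * h j.
Proof.
move=> c1; pose F i' j := if i' == i then c i j * h j else c i' j.
transitivity (\sum_(s : I) \prod_i' F i' (s i')).
  apply: eq_bigr => s _; rewrite (bigD1 i) //= [RHS](bigD1 i) //= /F eqxx mulrAC.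
  by congr (_ * _); apply: eq_bigr => i' /negPf ->.
rewrite -(bigA_distr_bigA F) (bigD1 i) //= [X in _ * X]big1 ?mulr1.
  by apply: eq_bigr => j _; rewrite /F eqxx.
by move=> i' /negPf ii; under eq_bigr do rewrite /F ii.
Qed.

Definition prod_vertex (s : I) : 'rV[R]_(r * 2) := mxvec (\matrix_i v (s i)).

(** One inclusion uses product weights, whose marginals are the given weights on the factors; the
    other passes to marginals. *)
Lemma product_power_hull : product_power r (convhull v) = hull prod_vertex [set: I]%SET.
Proof.
apply/seteqP; split=> y.
  move=> /choice[c cP]; exists (fun s : I => \prod_i c i (s i)); split=> //.
  - by move=> s; apply: prodr_ge0 => i _; case: (cP i).
  - by move=> s; rewrite finset.inE.
  - rewrite -(bigA_distr_bigA (fun i j => c i j)) /= big1 // => i _.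
    by case: (cP i).
  rewrite -[LHS]vec_mxK; apply: (canLR vec_mxK); apply/matrixP => i j.
  have [_ _ /rowP/(_ j)] := cP i; rewrite mxE => ->.
  rewrite linear_sum /= !summxE.
  rewrite (eq_bigr (fun j' => c i j' * v j' 0 j)) => [|j' _]; last by rewrite mxE.
  rewrite -(sum_prod_marginal i (fun j' => v j' 0 j)); last by move=> i'; case: (cP i').
  by apply: eq_bigr => s _; rewrite linearZ /= mxvecK !mxE.
move=> [c [c0 _ c1 ->]] i.
exists (fun j => \sum_(s : I | s i == j) c s); split.
- by move=> j; apply: sumr_ge0.
- by rewrite -[RHS]c1 [RHS](partition_big (fun s : I => s i) predT).
- transitivity (\sum_(s : I) c s *: v (s i)).
    by rewrite !linear_sum /=; apply: eq_bigr => s _; rewrite !linearZ /= mxvecK rowK.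
  rewrite (partition_big (fun s : I => s i) predT) //=; apply: eq_bigr => j _.
  by rewrite scaler_suml; apply: eq_bigr => s /eqP ->.
Qed.

Definition prod_row (i : 'I_r) (e : 'I_m) : 'rV[R]_(r * 2) :=
  mxvec (\matrix_i' (if i' == i then a e else 0)).

Lemma dot_prod_row i e (u : 'rV[R]_(r * 2)) :
  dot (prod_row i e) u = dot (a e) (row i (vec_mx u)).
Proof.
rewrite -{1}[u]vec_mxK dot_mxvec (bigD1 i) //= big1 ?addr0 ?rowK ?eqxx //.
by move=> i' /negPf ii; rewrite rowK ii dot0l.
Qed.

(** The product itself is a configuration with the identity as projection, for which the sum of the
    normals in [A] is a certificate. *)
Lemma product_skeleton k (S : {set I}) :
  exposed prod_vertex S /\
    (S = finset.set0 \/ exists2 j : nat, (j <= k)%N & has_dim (hull prod_vertex S) j)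
  <-> S = finset.set0 \/ exists (s : I) (A : {set 'I_r * bool}),
    (r * 2 - k <= #|A|)%N /\ S = pface s A.
Proof.
have dual (s : I) : exists delta : 'I_r * bool -> 'rV[R]_(r * 2), forall u,
    u = \sum_l dot (prod_row l.1 (edge (s l.1) l.2)) u *: delta l.
  apply: dual_family => u uP; rewrite -[u]vec_mxK.
  suff -> : vec_mx u = 0 by rewrite linear0.
  apply/row_matrixP => i; rewrite row0; apply: (edges_nondegenerate hm hme hv (j := s i)) => c.
  by rewrite -dot_prod_row (uP (i, c)).
have [delta deltaP] := choice dual.
have E (s : I) : prod_vertex s = prod_vertex s *m 1%:M by rewrite mulmx1.
have -> : prod_vertex = (fun s : I => prod_vertex s *m 1%:M) by apply/funext.
have pE i e (s : I) : dot (prod_row i e) (prod_vertex s) = dot (a e) (v (s i)).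
  by rewrite dot_prod_row mxvecK rowK.
apply: (skeleton_pface hm hme (rho := prod_row) (beta := fun _ => b) (delta := delta)) => //.
- by move=> i e s; rewrite pE; case: (hv e (s i)).
- by move=> i e s; rewrite pE; case: (hv e (s i)).
move=> s A _; exists (\sum_(l in A) prod_row l.1 (edge (s l.1) l.2)), (fun l => (l \in A)%:R).
split=> [l ->|l /negPf -> //|]; first exact: ltr01.
rewrite trmx1 mulmx1 big_mkcond; apply: eq_bigr => l _.
by case: (l \in A); rewrite ?scale1r ?scale0r.
Qed.

End Product.

(** * Deformed products *)

Section Deformed.
Variables (R : realType) (m r : nat) (v a : 'I_m -> 'rV[R]_2) (b : 'I_m -> R) (eps : R).
Hypotheses (hm : (2 < m)%N) (hme : ~~ odd m) (hv : edge_data v a b) (eps0 : 0 < eps).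
Notation I := {ffun 'I_r.+1 -> 'I_m}.

(* The left-hand sides of [a e . y_i <= M_i b e] for [e] even and of
   [(y_(i-1))_1 + eps a e . y_i <= eps M_i b e] for [e] odd. *)
Definition deformed_row (i : 'I_r.+1) (e : 'I_m) : 'rV[R]_(r.+1 * 2) :=
  mxvec (\matrix_i' (if i' == i then (if odd e then eps else 1) *: a e
                     else if odd e && (i'.+1 == i)%N then rv2 0 1 else 0)).

Lemma dot_deformed_row i e (y : nat -> 'rV[R]_2) :
  dot (deformed_row i e) (mxvec (\matrix_(i' < r.+1) y i')) =
  if odd e then (if val i is i'.+1 then y i' 0 1 else 0) + eps * dot (a e) (y i)
  else dot (a e) (y i).
Proof.
rewrite dot_mxvec (bigD1 i) //= !rowK eqxx dotZl.
case: (boolP (odd e)) => oe /=; last first.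
  rewrite mul1r big1 ?addr0 // => i' /negPf ii.
  by rewrite !rowK ii dot0l.
rewrite addrC; congr (_ + _).
case: i => -[|i] lti /=.
  by rewrite big1 // => i' /negPf ii; rewrite !rowK ii dot0l.
rewrite (bigD1 (Ordinal (ltnW lti))) /=; last by rewrite -val_eqE /=; lia.
rewrite !rowK -val_eqE /= (_ : (i == i.+1) = false) ?eqxx; last by lia.
rewrite dot2 rv2_0 rv2_1 mul0r mul1r add0r big1 ?addr0 // => i' /andP[/negPf ii /negPf i'i].
by rewrite !rowK ii eqSS (_ : (i' == i :> nat) = false) ?dot0l.
Qed.

(** The system is block triangular: the equations of polygon [i] involve only polygons [i - 1] and
    [i], and are solved upwards from 0. *)
Lemma deformed_nondegenerate (s : I) (u : 'rV[R]_(r.+1 * 2)) :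
  (forall l, dot (deformed_row l.1 (edge (s l.1) l.2)) u = 0) -> u = 0.
Proof.
pose y i := row (inord i) (vec_mx u).
have uE : u = mxvec (\matrix_(i' < r.+1) y i').
  rewrite -[LHS]vec_mxK; congr mxvec; apply/row_matrixP => i.
  by rewrite rowK /y inord_val.
rewrite uE => h.
have y0 i : (i < r.+1)%N -> y i = 0.
  elim: i => [|i IH] lti; apply: (edges_nondegenerate hm hme hv (j := s (Ordinal lti))) => c;
    have := h (Ordinal lti, c); rewrite dot_deformed_row /=; case: ifP => // _.
    by move/eqP; rewrite add0r mulf_eq0 (gt_eqF eps0) => /eqP.
  rewrite IH ?(ltnW lti) // mxE add0r.
  by move/eqP; rewrite mulf_eq0 (gt_eqF eps0) => /eqP.
rewrite (_ : (\matrix_i' y i') = 0) ?linear0 //.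
by apply/row_matrixP => i; rewrite rowK y0 // row0.
Qed.

(* Polygon [i] is dilated by [M i], chosen so large that the shift of its odd
   edges caused by polygon [i - 1] cannot change its combinatorial type. *)
Lemma deformed_vertices : exists (x : I -> 'rV[R]_(r.+1 * 2)) (beta : 'I_r.+1 -> 'I_m -> R),
  forall i e s, dot (deformed_row i e) (x s) <= beta i e /\
                (dot (deformed_row i e) (x s) == beta i e) = inc e (s i).
Proof.
have [delta deltaP] := choice (fun j => edge_direction hm hme hv j true).
(* [K] dominates the ratio of displacement to slack for every edge and vertex. An incident pair has
   slack 0 and contributes 0, the inverse of 0 being 0. *)
pose K := \sum_e \sum_j (1 + `|dot (a e) (delta j)|) / (eps * `|b e - dot (a e) (v j)|).
pose V := \sum_j `|v j 0 1| + \sum_j `|delta j 0 1|.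
(* [T i] bounds the shift [t sg i] that polygon [i] receives from its predecessor, whatever the
   vertices chosen. *)
pose T := fix T (i : nat) : R := if i is i'.+1 then (T i' * K + 1) * V + T i' / eps * V else 0.
pose M i := T i * K + 1.
pose t := fix t (sg : nat -> 'I_m) (i : nat) : R := if i is i'.+1 then
  (M i' *: v (sg i') - (t sg i' / eps) *: delta (sg i')) 0 1 else 0.
(* The dilated vertex slides along its even edge, the direction of [delta], by exactly what keeps it
   on the shifted odd edge. *)
pose y sg i := M i *: v (sg i) - (t sg i / eps) *: delta (sg i).
have K0 : 0 <= K.
  apply: sumr_ge0 => e _; apply: sumr_ge0 => j _.
  by rewrite divr_ge0 ?addr_ge0 // mulr_ge0 // ltW.
have vV j : `|v j 0 1| <= V.
  rewrite /V (bigD1 j) //= -addrA lerDl addr_ge0 //; apply: sumr_ge0 => *; exact: normr_ge0.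
have dV j : `|delta j 0 1| <= V.
  rewrite /V [X in _ + X](bigD1 j) //= addrCA lerDl addr_ge0 //; apply: sumr_ge0 => *; exact: normr_ge0.
have V0 : 0 <= V by exact: le_trans (normr_ge0 _) (vV (Ordinal (ltnW (ltnW hm)))).
have T0 i : 0 <= T i.
  elim: i => //= i IH; rewrite addr_ge0 // mulr_ge0 //.
    by rewrite addr_ge0 // mulr_ge0.
  by rewrite divr_ge0 // ltW.
have M0 i : 0 < M i by rewrite /M ltr_wpDl // mulr_ge0.
have tT sg i : `|t sg i| <= T i.
  elim: i => [|i IH]; first by rewrite /= normr0.
  rewrite /= !mxE (le_trans (ler_normB _ _)) // lerD // !normrM.
    by rewrite gtr0_norm ?M0 // ler_wpM2l //; exact: ltW (M0 i).
  rewrite normfV (gtr0_norm eps0) ler_pM ?divr_ge0 ?(ltW eps0) //.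
  by rewrite ler_wpM2r ?invr_ge0 // ltW.
pose sg (s : I) (i : nat) : 'I_m := s (inord i).
exists (fun s => mxvec (\matrix_(i' < r.+1) y (sg s) i')).
exists (fun (i : 'I_r.+1) (e : 'I_m) => (if odd e then eps else 1) * (M i * b e)) => i e s.
rewrite dot_deformed_row.
have -> : (if val i is i'.+1 then y (sg s) i' 0 1 else 0) = t (sg s) i.
  by case: i => -[|i] lti.
have dy : dot (a e) (y (sg s) i) = M i * dot (a e) (v (s i)) - t (sg s) i / eps * dot (a e) (delta (s i)).
  by rewrite /y dotBr !dotZr /sg inord_val.
rewrite dy; set j := s i in dy *; set tau := t (sg s) i.
have [d1 d0] := deltaP j.
have ne : eps != 0 by rewrite gt_eqF.
case: (boolP (inc e j)) => ie.
  have [_] := hv e j; rewrite ie => /eqP ->.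
  have eE := incP hm hme ie.
  suff -> : (if odd e then tau + eps * (M i * b e - tau / eps * dot (a e) (delta j))
     else M i * b e - tau / eps * dot (a e) (delta j)) =
     (if odd e then eps else 1) * (M i * b e) by rewrite eqxx lexx.
  case: (boolP (odd e)) eE => oe eE; rewrite eE.
    by rewrite d1; field.
  by rewrite d0; ring.
suff lt : (if odd e then tau + eps * (M i * dot (a e) (v j) - tau / eps * dot (a e) (delta j))
     else M i * dot (a e) (v j) - tau / eps * dot (a e) (delta j)) <
     (if odd e then eps else 1) * (M i * b e) by rewrite ltW // lt_eqF.
set D := dot (a e) (delta j).
have g0 : 0 < b e - dot (a e) (v j).
  by have [h1 h2] := hv e j; rewrite subr_gt0 lt_neqAle h1 h2 ie.
have gap : `|tau| * (1 + `|D|) < eps * M i * (b e - dot (a e) (v j)).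
  have k1 : (1 + `|D|) / (eps * (b e - dot (a e) (v j))) <= K.
    rewrite /K (bigD1 e) //= (bigD1 j) //= (gtr0_norm g0) -addrA lerDl addr_ge0 //.
      by apply: sumr_ge0 => j' _; rewrite divr_ge0 ?addr_ge0 // mulr_ge0 // ltW.
    apply: sumr_ge0 => e' _; apply: sumr_ge0 => j' _.
    by rewrite divr_ge0 ?addr_ge0 // mulr_ge0 // ltW.
  rewrite ler_pdivrMr in k1; last exact: mulr_gt0.
  have k2 : `|tau| <= T i by exact: tT.
  apply: (@le_lt_trans _ _ (T i * (K * (eps * (b e - dot (a e) (v j)))))).
    by rewrite ler_pM // addr_ge0.
  rewrite /M; have := mulr_gt0 eps0 g0; lra.
have n1 := ler_norm tau; have n2 : - (tau * D) <= `|tau| * `|D|.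
  by rewrite -normrM -normrN ler_norm.
case: (odd e).
  have -> : tau + eps * (M i * dot (a e) (v j) - tau / eps * D) =
    tau + eps * (M i * dot (a e) (v j)) - tau * D by field.
  lra.
have n0 := normr_ge0 tau.
rewrite -(ltr_pM2l eps0).
have -> : eps * (M i * dot (a e) (v j) - tau / eps * D) =
  eps * (M i * dot (a e) (v j)) - tau * D by field.
lra.
Qed.

End Deformed.

(** * Perturbation of a triangular recurrence *)

Lemma small_horner_gt0 (R : realType) (f : {poly R}) : 0 < f.[0] -> small (fun t => 0 < f.[t]).
Proof.
have bnd (g : {poly R}) : exists B, forall t, 0 < t < 1 -> `|g.[t]| <= B.
  elim/poly_ind: g => [|g c [B gB]]; first by exists 0 => t _; rewrite horner0 normr0.
  exists (B + `|c|) => t tI; rewrite hornerMXaddC (le_trans (ler_normD _ _)) // lerD2r normrM.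
  have /andP[t0 t1] := tI; have := gB t tI; have := normr_ge0 g.[t].
  rewrite (gtr0_norm t0); nra.
elim/poly_ind: f => [|g c _]; first by rewrite horner0 ltxx.
rewrite hornerMXaddC mulr0 add0r => c0; have [B gB] := bnd g.
have h1 : small (fun t : R => `|g.[t]| <= B) by exists 1.
have [e e0 he] := small_and h1 (small_ltM B c0).
exists e => // t te; have [h2 h3] := he t te; rewrite hornerMXaddC.
have /andP[t0 _] := te; have := ler_normr (- g.[t]) g.[t]; have := ler_norm (- g.[t]).
rewrite normrN; nra.
Qed.

Section Recurrence.
Variables (R : realType) (p q : nat -> R).

(* The pair of the [j]-th and the [(j-1)]-st coefficients. *)
Fixpoint coefs (A : comPzRingType) (p q : nat -> A) (eps : A) (F : nat -> A) (nu : A) (j : nat) : A * A :=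
  if j is j'.+1 then
    let x := coefs p q eps F nu j' in (F j' - p j' * (eps * x.1) - q j' * (eps ^+ 2 * x.2), x.1)
  else (nu, 0).

(** The same recurrence run over [{poly R}] with parameter ['X]: each coefficient is a polynomial in
    [eps], so its sign at 0 persists for small values. *)
Let pcoefs (F : nat -> R) (nu : R) j : {poly R} :=
  (coefs (fun j => (p j)%:P) (fun j => (q j)%:P) 'X (fun j => (F j)%:P) nu%:P j).1.

Lemma horner_coefs F nu j eps : (pcoefs F nu j).[eps] = (coefs p q eps F nu j).1.
Proof.
rewrite /pcoefs.
suff [] : (coefs (fun j => (p j)%:P) (fun j => (q j)%:P) 'X (fun j => (F j)%:P) nu%:P j).1.[eps]
   = (coefs p q eps F nu j).1 /\
   (coefs (fun j => (p j)%:P) (fun j => (q j)%:P) 'X (fun j => (F j)%:P) nu%:P j).2.[eps]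
   = (coefs p q eps F nu j).2 by [].
elim: j => [|j [IH1 IH2]] /=; first by rewrite !hornerE.
by rewrite !hornerE IH1 IH2.
Qed.

Lemma coefs_lin (J : finType) eps (F0 : nat -> R) nu (F : J -> nat -> R) (th : J -> R) j :
  (coefs p q eps (fun i => F0 i + \sum_z th z * F z i) nu j).1 =
  (coefs p q eps F0 nu j).1 + \sum_z th z * (coefs p q eps (F z) 0 j).1.
Proof.
suff [] : (coefs p q eps (fun i => F0 i + \sum_z th z * F z i) nu j).1 =
   (coefs p q eps F0 nu j).1 + \sum_z th z * (coefs p q eps (F z) 0 j).1 /\
  (coefs p q eps (fun i => F0 i + \sum_z th z * F z i) nu j).2 =
   (coefs p q eps F0 nu j).2 + \sum_z th z * (coefs p q eps (F z) 0 j).2 by [].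
elim: j => [|j [IH1 IH2]] /=.
  by split; rewrite big1 ?addr0 // => z _; rewrite mulr0.
split=> //; rewrite IH1 IH2.
under [in RHS]eq_bigr do rewrite !mulrBr.
rewrite !sumrB !mulrDr !mulr_sumr.
have -> : \sum_z th z * (p j * (eps * (coefs p q eps (F z) 0 j).1)) =
   \sum_z p j * (eps * (th z * (coefs p q eps (F z) 0 j).1)).
  by apply: eq_bigr => z _; ring.
have -> : \sum_z th z * (q j * (eps ^+ 2 * (coefs p q eps (F z) 0 j).2)) =
   \sum_z q j * (eps ^+ 2 * (th z * (coefs p q eps (F z) 0 j).2)).
  by apply: eq_bigr => z _; ring.
ring.
Qed.

Lemma coefs_at0 F nu j : (coefs p q 0 F nu j.+1).1 = F j.
Proof. by rewrite /= expr0n /= !mul0r !mulr0 !subr0. Qed.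

(* Cramer's rule over [{poly R}]: the unperturbed system is the identity. *)
Lemma perturbed_coefs N (Z : {set 'I_N}) (F0 : nat -> R) nu (F : 'I_N -> nat -> R) :
  (forall j : 'I_N, j \in Z -> F0 j = 0) -> (forall j : 'I_N, j \notin Z -> 0 < F0 j) ->
  (forall z, z \notin Z -> forall j, F z j = 0) ->
  (forall z j : 'I_N, z \in Z -> j \in Z -> F z j = (z == j)%:R) ->
  small (fun eps => exists th : 'I_N -> R, forall j : 'I_N,
    let x := (coefs p q eps (fun i => F0 i + \sum_z th z * F z i) nu j.+1).1 in
    if j \in Z then x = 0 else 0 < x).
Proof.
move=> F0Z F0pos FZ0 FZ.
(* The unknowns are the weights [th z]. Rows in [Z] demand that a coefficient vanish, and rows
   outside [Z] force [th j = 0]. *)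
pose M : 'M[{poly R}]_N := \matrix_(j, z) if j \in Z then pcoefs (F z) 0 j.+1 else (j == z)%:R.
pose G : 'cV[{poly R}]_N := \col_j if j \in Z then pcoefs F0 nu j.+1 else 0.
have [D DE] : {D | D = \det M} by exists (\det M).
pose Th := - (\adj M *m G).
(* The corrected coefficient multiplied by the determinant, which keeps it a polynomial in [eps]; at
   0 it equals [F0 j] for [j] outside [Z]. *)
pose H (j : 'I_N) := D * pcoefs F0 nu j.+1 + \sum_z Th z 0 * pcoefs (F z) 0 j.+1.
have M0 : map_mx (horner_eval 0) M = 1%:M.
  apply/matrixP => j z; rewrite !mxE /horner_eval; case: ifP => jZ.
    rewrite horner_coefs coefs_at0; case: (boolP (z \in Z)) => zZ.
      by rewrite FZ // eq_sym.
    by rewrite FZ0 //; case: eqP zZ => // <-; rewrite jZ.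
  by case: (j == z); rewrite ?mulr1n ?mulr0n hornerE.
have D0 : D.[0] = 1 by rewrite -[LHS]/(horner_eval 0 D) DE -det_map_mx M0 det1.
have G0 : map_mx (horner_eval 0) G = 0.
  apply/matrixP => j z; rewrite !mxE /horner_eval; case: ifP => jZ; last by rewrite hornerE.
  by rewrite horner_coefs coefs_at0 F0Z.
have Th0 z : (Th z 0).[0] = 0.
  rewrite -[LHS]/(horner_eval 0 (Th z 0)) /Th.
  have := congr1 (fun A : 'cV_N => A z 0) (map_mxM (horner_eval 0) (\adj M) G).
  rewrite G0 mulmx0 [LHS]mxE [RHS]mxE => h.
  by rewrite [X in horner_eval _ X]mxE rmorphN /= h oppr0.
have H0 j : j \notin Z -> 0 < (H j).[0].
  move=> jZ; rewrite /H hornerD hornerM horner_sum D0 mul1r horner_coefs coefs_at0 big1 ?addr0 ?F0pos //.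
  by move=> z _; rewrite hornerM Th0 mul0r.
have HZ j : j \in Z -> H j = 0.
  move=> jZ; have : (M *m Th) j 0 = - D * G j 0.
    by rewrite /Th mulmxN mulmxA mul_mx_adj -DE mul_scalar_mx 2!mxE mulNr.
  rewrite /H [X in - D * X]mxE jZ [in LHS]mxE => E; apply/eqP; rewrite addrC addr_eq0 -mulNr -E; apply/eqP.
  by apply: eq_bigr => z _; rewrite [M j z]mxE jZ mulrC.
have Dsmall : small (fun t => 0 < D.[t]) by apply: small_horner_gt0; rewrite D0 ltr01.
have Hsmall (j : 'I_N) : small (fun t => j \notin Z -> 0 < (H j).[t]).
  case: (boolP (j \in Z)) => jZ; first by exists 1.
  by have [e e0 h] := small_horner_gt0 (H0 j jZ); exists e => // t /h.
have [e e0 he] := small_and Dsmall (small_forall Hsmall).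
exists e => // t /he[Dt Ht].
exists (fun z => (Th z 0).[t] / D.[t]) => j.
have xE : (coefs p q t (fun i => F0 i + \sum_z (Th z 0).[t] / D.[t] * F z i) nu j.+1).1 =
    (H j).[t] / D.[t].
  rewrite coefs_lin /H hornerD hornerM horner_sum horner_coefs mulrDl mulrAC divff ?gt_eqF // mul1r.
  rewrite mulr_suml; congr (_ + _); apply: eq_bigr => z _.
  by rewrite hornerM horner_coefs mulrAC.
rewrite [X in let x := X in _]xE /=; case: ifP => jZ.
  by rewrite HZ // horner0 mul0r.
by rewrite divr_gt0 // Ht // jZ.
Qed.

End Recurrence.

(** * Strictly preserved faces *)

Section Parabola.
Variables (R : realType) (m : nat) (eps : R).
Hypotheses (hm : (2 < m)%N) (hme : ~~ odd m).

Definition slope1 (e : 'I_m) : R := if e.+1 == m then -1 else 1.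
Definition slope2 (e : 'I_m) : R := if e.+1 == m then - (m.-1)%:R else (e.*2.+1)%:R.
(** An [m]-gon inscribed in a parabola, stretched by [1 / eps] in the second coordinate so that its
    edge normals tend to [(1, 0)], or to [(-1, 0)] for the closing edge. *)
Definition parabola_vertex (j : 'I_m) : 'rV[R]_2 := rv2 (- j%:R ^+ 2) (j%:R / eps).
Definition parabola_edge (e : 'I_m) : 'rV[R]_2 := rv2 (slope1 e) (eps * slope2 e).
Definition parabola_rhs (e : 'I_m) : R := if e.+1 == m then 0 else (e * e.+1)%:R.

(** The closing edge [m - 1] is odd since [m] is even, hence all even edges share their limit
    normal. *)
Lemma slope1_even (e : 'I_m) : ~~ odd e -> slope1 e = 1.
Proof. by rewrite /slope1; case: eqP => // h; lia. Qed.

Lemma parabola_edge_data : eps != 0 -> edge_data parabola_vertex parabola_edge parabola_rhs.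
Proof.
move=> e0 e j; rewrite -subr_ge0 eq_sym -subr_eq0.
have -> : parabola_rhs e - dot (parabola_edge e) (parabola_vertex j) =
    (if e.+1 == m then (j * (m.-1 - j))%:R else (if (j <= e)%N then ((e - j) * (e.+1 - j))%:R
      else ((j - e) * (j - e.+1))%:R)) :> R.
  rewrite dot2 !rv2_0 !rv2_1 /parabola_rhs /slope1 /slope2.
  have jm := ltn_ord j; case: eqP => [em|em].
    rewrite natrM natrB; last by lia.
    by field.
  case: leqP => je.
    rewrite !natrM !natrB ?(leqW je) // -addn1 -muln2 -(addn1 (e * 2)) !natrD natrM.
    by field.
  rewrite !natrM !natrB ?(ltnW je) // -addn1 -muln2 -(addn1 (e * 2)) !natrD natrM.
  by field.
split; first by case: ifP => _; [|case: ifP => _]; exact: ler0n.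
have jm := ltn_ord j; have em := ltn_ord e.
rewrite /inc -!val_eqE /=; case: (eqVneq e.+1 m) => eS.
  by rewrite pnatr_eq0 muln_eq0 eS modnn; lia.
rewrite modn_small; last by lia.
by case: (leqP j e) => je; rewrite pnatr_eq0 muln_eq0; lia.
Qed.

End Parabola.

Section Certificate.
Variables (R : realType) (m r d : nat).
Hypotheses (hm : (2 < m)%N) (hme : ~~ odd m) (hdr : (d <= r.+1 * 2)%N).
Notation I := {ffun 'I_r.+1 -> 'I_m}.
Notation N := (r.+1 * 2)%N.

(** A functional with coefficients [c] pulls back to the values of the polynomial with these
    coefficients at the nodes from 0 to [N - 1]. *)
Definition vandermonde : 'M[R]_(N, d) :=
  \matrix_(l, j) mxvec (\matrix_(i < r.+1, b < 2) (i.*2 + b)%:R ^+ j) 0 l.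

Lemma vandermonde_mul (c : 'rV[R]_d) :
  c *m vandermonde^T = mxvec (\matrix_(i, b) (rVpoly c).[(i.*2 + b)%:R]).
Proof.
apply/rowP => l; case/mxvec_indexP: l => i b; rewrite mxvecE !mxE.
rewrite (horner_coef_wide _ (size_poly _ _)); apply: eq_bigr => j _.
by rewrite !mxE mxvecE mxE coef_rVpoly_ord.
Qed.

Lemma vandermonde_full : row_full vandermonde.
Proof.
rewrite /row_full -mxrank_tr -/(row_free _); apply: inj_row_free => c.
rewrite vandermonde_mul => /(congr1 vec_mx); rewrite mxvecK linear0 => h.
suff c0 : rVpoly c = 0 by rewrite -[c]rVpolyK c0 linear0.
apply: (@roots_geq_poly_eq0 _ _ [seq (j%:R : R) | j <- iota 0 N]).
- apply/allP => z /mapP[j]; rewrite mem_iota add0n => /= jN -> {z}.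
  have jr : (j./2 < r.+1)%N by lia.
  have jb : (odd j < 2)%N by case: (odd j).
  move/matrixP: h => /(_ (Ordinal jr) (Ordinal jb)); rewrite !mxE /= => h.
  by rewrite /root (_ : j = j./2.*2 + odd j)%N ?h //; lia.
- rewrite map_inj_uniq ?iota_uniq // => i j /eqP; rewrite eqr_nat => /eqP //.
- by rewrite size_map size_iota (leq_trans (size_poly _ _)).
Qed.

Lemma size_prod_sub (n : nat) (Z : {set 'I_n}) :
  size (\prod_(z in Z) ('X - (z%:R : R)%:P)) = #|Z|.+1.
Proof. by rewrite -big_enum /= size_prod_XsubC -cardE. Qed.

(* As [eps] tends to [0], the row [l] tends to the coordinate with node [idx l - 1]
   (to [0] if [idx l = 0]); no row has the last node as its limit. *)
Let idx (l : 'I_r.+1 * bool) : nat := (l.1.*2 + ~~ l.2)%N.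

(** Comparing coordinates turns a combination of facet normals into a three-term recurrence for its
    coefficients. The condition [kap N = 0] stands for the absent polygon after the last. *)
Lemma deformed_row_sum (s : I) (eps : R) (kap : nat -> R) (F : nat -> R) :
  kap N = 0 ->
  (forall i : 'I_r.+1, F i.*2 = kap i.*2.+1 + eps * slope1 R (edge (s i) true) * kap i.*2) ->
  (forall i : 'I_r.+1, F i.*2.+1 = kap i.*2.+2 + eps * slope2 R (edge (s i) false) * kap i.*2.+1
     + eps ^+ 2 * slope2 R (edge (s i) true) * kap i.*2) ->
  \sum_l kap (idx l) *: deformed_row (parabola_edge eps) eps l.1 (edge (s l.1) l.2)
  = mxvec (\matrix_(i, b) F (i.*2 + b)%N).
Proof.
move=> kapN F0 F1; apply: (canRL vec_mxK); apply/matrixP => i b.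
rewrite linear_sum summxE [RHS]mxE.
pose G i' : R := if i' == i then kap i.*2 * (eps * parabola_edge eps (edge (s i) true) 0 b)
     + kap i.*2.+1 * parabola_edge eps (edge (s i) false) 0 b
  else if (i.+1 == i')%N then kap i'.*2 * rv2 0 1 0 b else 0.
transitivity (\sum_(i' < r.+1) G i').
  rewrite -(pair_bigA _ (fun i' c => vec_mx (kap (idx (i', c)) *:
    deformed_row (parabola_edge eps) eps i' (edge (s i') c)) i b)) /=.
  apply: eq_bigr => i' _; rewrite big_bool /= !linearZ /= !mxvecK !odd_edge //.
  rewrite /idx /= addn0 addn1 !mxE /G eq_sym; case: eqP => [->|_]; first by rewrite !mxE mul1r.
  by case: ifP => _; rewrite !mxE ?mulr0 addr0.
rewrite (bigD1 i) //= {1}/G eqxx.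
have -> : \sum_(i' < r.+1 | i' != i) G i' = kap i.*2.+2 * rv2 0 1 0 b.
  have [iS|iS] := ltnP i.+1 r.+1.
    rewrite (bigD1 (Ordinal iS)) /=; last by rewrite -val_eqE /=; lia.
    rewrite {1}/G -val_eqE /= eqxx (_ : (i.+1 == i) = false); last by lia.
    rewrite big1 ?addr0 // => i' /andP[/negPf h1 /negPf h2].
    by rewrite /G h1 ifF // -h2 -val_eqE eq_sym.
  have -> : i.*2.+2 = N by have := ltn_ord i; lia.
  rewrite kapN mul0r big1 // => i' /negPf h1.
  by rewrite /G h1 ifF //; have := ltn_ord i'; lia.
clear G; case: b => -[|[|//]] b2.
  rewrite (_ : Ordinal b2 = 0); last exact: val_inj.
  rewrite /parabola_edge !rv2_0 /= addn0 F0 (@slope1_even R m hm hme (edge (s i) false)) ?odd_edge //; ring.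
rewrite (_ : Ordinal b2 = 1); last exact: val_inj.
rewrite /parabola_edge !rv2_1 /= addn1 F1; ring.
Qed.

Lemma certificate (k : nat) (s : I) (A : {set 'I_r.+1 * bool}) :
  (k.*2.+2 <= d)%N -> (N - k <= #|A|)%N ->
  small (fun eps : R => exists (c : 'rV[R]_d) (lam : 'I_r.+1 * bool -> R),
    [/\ forall l, l \in A -> 0 < lam l, forall l, l \notin A -> lam l = 0
      & c *m vandermonde^T = \sum_l lam l *:
          deformed_row (parabola_edge eps) eps l.1 (edge (s l.1) l.2)]).
Proof.
move=> kd kA.
(* The nodes where the polynomial must vanish in the limit: the last one, and those approached by
   normals outside [A]. The row with [idx] equal to 0 approaches none. *)
pose Z : {set 'I_N} :=
  [set j : 'I_N | (j.+1 == N) || [exists l, (l \notin A) && (idx l == j.+1)]]%SET.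
have lastN : (N.-1 < N)%N by [].
pose last : 'I_N := Ordinal lastN.
pose Z' := (Z :\ last)%SET.
have idx_inj l l' : idx l = idx l' -> l = l'.
  case: l l' => [i c] [i' c']; rewrite /idx /= => E.
  have cc : c = c' by case: c c' E => -[] //=; lia.
  by subst c'; congr pair; apply: val_inj => /=; lia.
have idx_lt l : (idx l < N)%N.
  by case: l => i c; have := ltn_ord i; rewrite /idx /=; case: c => /=; lia.
have lastZ : last \in Z by rewrite finset.inE; apply/orP; left; apply/eqP.
have cZ' : (#|Z'| <= k)%N.
  pose g (j : 'I_N) : 'I_r.+1 * bool := (inord j.+1./2, ~~ odd j.+1).
  have gE j : j \in Z' -> idx (g j) = j.+1.
    rewrite !finset.inE -val_eqE /= => /andP[jl _]; have := ltn_ord j.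
    by rewrite /idx /g /= => jN; rewrite inordK; lia.
  have ginj : {in Z' &, injective g}.
    by move=> i j iZ jZ E; apply: val_inj; apply: succn_inj; rewrite -!gE // E.
  rewrite -(card_in_imset ginj).
  apply: (@leq_trans #|~: A|).
    apply: subset_leq_card; apply/fintype.subsetP => _ /imsetP[j jZ ->].
    rewrite finset.inE; move: (jZ); rewrite !finset.inE -val_eqE /= => /andP[jl /orP[/eqP|]]; first by lia.
    case/existsP => l /andP[lA /eqP lE]; rewrite (idx_inj (g j) l) //.
    by rewrite gE.
  by rewrite cardsCs finset.setCK card_prod card_ord card_bool; lia.
have cZ : (#|Z| <= k.+1)%N by rewrite (cardsD1 last) lastZ.
pose pz (S : {set 'I_N}) : {poly R} := \prod_(z in S) ('X - (z%:R : R)%:P).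
have pz_eq0 S (j : 'I_N) : (pz S).[j%:R] = 0 <-> j \in S.
  rewrite /pz horner_prod; split=> [/eqP|jS].
    by move/prodf_eq0 => [z zS]; rewrite hornerXsubC subr_eq0 eqr_nat val_eqE => /eqP ->.
  by apply/eqP/prodf_eq0; exists j => //; rewrite hornerXsubC subrr.
(* Double zeros at [Z'], where the sign must not change, and a simple zero at the last node, beyond
   which there is no other. The degree is at most [k.*2.+1]. *)
pose f0 : {poly R} := ((N.-1)%:R%:P - 'X) * pz Z' ^+ 2.
(* The Lagrange basis on [Z], with the zero polynomial for other indices: the corrections that
   absorb the deformation. *)
pose lag (z : 'I_N) := if z \in Z then (pz (Z :\ z)%SET).[z%:R]^-1 *: pz (Z :\ z)%SET else 0.
pose e_od i := edge (s (inord i)) true.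
pose e_ev i := edge (s (inord i)) false.
pose p j : R := if odd j then slope2 R (e_ev j./2) else slope1 R (e_od j./2).
pose q j : R := if odd j then slope2 R (e_od j./2) else 0.
(* The row with [idx] equal to 0 tends to 0, so its coefficient can be prescribed as the initial
   value of the recurrence. *)
pose nu : R := ((ord0, true) \in A)%:R.
have f0Z (j : 'I_N) : j \in Z -> f0.[j%:R] = 0.
  move=> jZ; rewrite /f0 hornerM; case: (eqVneq j last) => [->|jl].
    by rewrite hornerD hornerN hornerX hornerC subrr mul0r.
  by rewrite horner_exp (_ : (pz Z').[j%:R] = 0) ?expr0n ?mulr0 //; apply/pz_eq0; rewrite finset.in_setD1 jl.
have f0pos (j : 'I_N) : j \notin Z -> 0 < f0.[j%:R].
  move=> jZ; have jl : j != last by apply: contraNneq jZ => ->.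
  rewrite /f0 hornerM mulr_gt0 //.
    rewrite hornerD hornerN hornerX hornerC subr_gt0 ltr_nat.
    by move: jl; rewrite -val_eqE /=; have := ltn_ord j; lia.
  rewrite horner_exp lt_neqAle sqr_ge0 andbT eq_sym sqrf_eq0.
  apply: contra jZ => /eqP/pz_eq0; rewrite !finset.in_setD1 => /andP[_].
  by [].
have lag0 z : z \notin Z -> forall j, (lag z).[j%:R] = 0.
  by move=> zZ j; rewrite /lag (negPf zZ) horner0.
have lagE z (j : 'I_N) : z \in Z -> j \in Z -> (lag z).[j%:R] = (z == j)%:R.
  move=> zZ jZ; rewrite /lag zZ hornerZ; case: (eqVneq z j) => [<-|zj].
    rewrite mulVf //; apply/eqP => /pz_eq0.
    by rewrite finset.in_setD1 eqxx.
  rewrite (_ : (pz _).[j%:R] = 0) ?mulr0 //; apply/pz_eq0.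
  by rewrite finset.in_setD1 eq_sym zj.
have [e e0 he] := perturbed_coefs p q (F0 := fun j => f0.[j%:R]) nu
  (F := fun z j => (lag z).[j%:R]) f0Z f0pos lag0 lagE.
exists e => // eps /he[th thP].
pose f := f0 + \sum_z th z *: lag z.
pose kap j := (coefs p q eps (fun j => f.[j%:R]) nu j).1.
have kapP (j : 'I_N) : if j \in Z then kap j.+1 = 0 else 0 < kap j.+1.
  have := thP j; rewrite /kap.
  suff -> : (fun i : nat => f0.[i%:R] + \sum_z th z * (lag z).[i%:R]) = (fun i : nat => f.[i%:R]) by [].
  apply/funext => i; rewrite /f hornerD horner_sum; congr (_ + _).
  by apply: eq_bigr => z _; rewrite hornerZ.
have szf : (size f <= d)%N.
  rewrite /f (leq_trans (size_polyD _ _)) // geq_max; apply/andP; split.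
    rewrite (leq_trans (size_polyMleq _ _)) //.
    have s1 : (size ((N.-1)%:R%:P - 'X : {poly R})%R <= 2)%N.
      by rewrite -opprB size_polyN size_XsubC.
    have s2 := size_poly_exp_leq (pz Z') 2.
    rewrite size_prod_sub /= in s2; clear -s1 s2 cZ' kd; move: (size _) (size _) #|_| s1 s2 cZ' => x y z; lia.
  rewrite (leq_trans (size_sum _ _ _)) //; apply/bigmax_leqP => z _.
  rewrite (leq_trans (size_scale_leq _ _)) // /lag; case: ifP => zZ; last by rewrite size_poly0.
  rewrite (leq_trans (size_scale_leq _ _)) // size_prod_sub.
  by move: cZ; rewrite (cardsD1 z) zZ add1n => h; apply: leq_trans h _; clear -kd; lia.
exists (poly_rV f), (fun l => kap (idx l)); split.
- move=> l lA; case E : (idx l) => [|j].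
    rewrite (idx_inj l (ord0, true)) // in lA.
    by rewrite /kap /= /nu lA ltr01.
  have jN : (j < N)%N by apply: ltnW; rewrite -E; exact: idx_lt.
  have := kapP (Ordinal jN); rewrite ifF //; apply/negbTE; rewrite finset.inE /= negb_or.
  apply/andP; split; first by rewrite -E ltn_eqF ?idx_lt.
  apply/existsP => -[l' /andP[l'A /eqP l'E]].
  by rewrite (idx_inj l' l) ?lA // in l'A; rewrite E.
- move=> l lA; case E : (idx l) => [|j].
    rewrite (idx_inj l (ord0, true)) // in lA.
    by rewrite /kap /= /nu (negPf lA).
  have jN : (j < N)%N by apply: ltnW; rewrite -E; exact: idx_lt.
  have := kapP (Ordinal jN); rewrite ifT // finset.inE /=.
  by apply/orP; right; apply/existsP; exists l; rewrite lA E eqxx.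
- rewrite vandermonde_mul poly_rV_K //.
  rewrite (@deformed_row_sum s eps kap (fun j => f.[j%:R])) //.
  + by have := kapP last; rewrite lastZ.
  + move=> i.
    have -> : kap i.*2.+1 = f.[i.*2%:R] - p i.*2 * (eps * kap i.*2) -
      q i.*2 * (eps ^+ 2 * (coefs p q eps (fun j => f.[j%:R]) nu i.*2).2) by [].
    by rewrite /p /q odd_double doubleK /e_od inord_val; ring.
  + move=> i.
    have -> : kap i.*2.+2 = f.[i.*2.+1%:R] - p i.*2.+1 * (eps * kap i.*2.+1) -
      q i.*2.+1 * (eps ^+ 2 * kap i.*2) by [].
    by rewrite /p /q /= odd_double /= uphalf_double /e_od /e_ev inord_val; ring.
Qed.

End Certificate.

(** * The projected deformed product *)

Section Projected.
Variables (R : realType) (m r d k : nat).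
Hypotheses (hm : (2 < m)%N) (hme : ~~ odd m) (hdr : (d <= r.+1 * 2)%N) (hkd : (k.*2.+2 <= d)%N).
Notation I := {ffun 'I_r.+1 -> 'I_m}.

(** Certificates involve the normals only, so [eps] is fixed first, for all vertices and facet sets,
    and the vertices of the deformed product are constructed for that [eps]. *)
Lemma projected_deformed_product : exists q : I -> 'rV[R]_d,
  has_dim (hull q [set: I]%SET) d /\
  forall S, exposed q S /\ (S = finset.set0 \/ exists2 j : nat, (j <= k)%N & has_dim (hull q S) j)
    <-> S = finset.set0 \/ exists (s : I) (A : {set 'I_r.+1 * bool}),
          (r.+1 * 2 - k <= #|A|)%N /\ S = pface s A.
Proof.
pose cert (sA : I * {set 'I_r.+1 * bool}) (eps : R) := (r.+1 * 2 - k <= #|sA.2|)%N ->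
  exists (c : 'rV[R]_d) (lam : 'I_r.+1 * bool -> R),
    [/\ forall l, l \in sA.2 -> 0 < lam l, forall l, l \notin sA.2 -> lam l = 0
      & c *m (vandermonde R r d)^T = \sum_l lam l *:
          deformed_row (parabola_edge eps) eps l.1 (edge (sA.1 l.1) l.2)].
have [eps eps0 epsP] : exists2 eps, 0 < eps & forall sA, cert sA eps.
  apply: small_ex; apply: small_forall => -[s A]; rewrite /cert.
  case: (boolP (r.+1 * 2 - k <= #|A|)%N) => kA; last by exists 1.
  have [e e0 he] := certificate R hm hme hdr s hkd kA.
  by exists e => // t /he.
have hv := @parabola_edge_data R m eps hm hme (lt0r_neq0 eps0).
have [x [beta xP]] := deformed_vertices r hm hme hv eps0.
have dual (s : I) : exists delta : 'I_r.+1 * bool -> 'rV[R]_(r.+1 * 2), forall u,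
    u = \sum_l dot (deformed_row (parabola_edge eps) eps l.1 (edge (s l.1) l.2)) u *: delta l.
  by apply: dual_family => u; exact: (deformed_nondegenerate hm hme hv eps0).
have [delta deltaP] := choice dual.
have le i e s : dot (deformed_row (parabola_edge eps) eps i e) (x s) <= beta i e.
  by case: (xP i e s).
have eq i e s : (dot (deformed_row (parabola_edge eps) eps i e) (x s) == beta i e) = inc e (s i).
  by case: (xP i e s).
exists (fun s => x s *m vandermonde R r d); split.
  have m0 : (0 < m)%N by apply: leq_trans hm.
  apply: (has_dim_full hm hme eq deltaP [ffun=> Ordinal m0]).
  exact: vandermonde_full.
by apply: (skeleton_pface hm hme le eq deltaP) => s A; exact: (epsP (s, A)).
Qed.

End Projected.

Theorem theorem4p1 (R : realType) (m r d : nat) (P : set 'rV[R]_2)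
  (hm : (4 <= m)%N) (hme : ~~ odd m) (hr : (1 <= r)%N)
  (hd2 : (2 <= d)%N) (hdr : (d <= 2 * r)%N) (hP : polygon m P) :
  exists (n : nat) (Q : set 'rV[R]_n),
    [/\ polytope Q, has_dim Q d &
        poset_iso (skeleton (d./2 - 1)%N Q)
                  (skeleton (d./2 - 1)%N (product_power r P))].
Proof.
case: r hr hdr => // r _ hdr.
have m2 : (2 < m)%N by apply: ltnW.
have dr : (d <= r.+1 * 2)%N by rewrite mulnC.
have kd : ((d./2 - 1).*2.+2 <= d)%N by lia.
have [v [a [b [-> hv]]]] := polygon_edges m2 hP.
have [q [qd qS]] := projected_deformed_product R m2 hme dr kd.
exists d, (hull q [set: {ffun 'I_r.+1 -> 'I_m}]%SET); split=> //.
  by rewrite hullE; exists #|{: {ffun 'I_r.+1 -> 'I_m}}|, (fun i => q (enum_val i)).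
(* Both skeleta are described by the same index sets [pface s A]. *)
rewrite product_power_hull; apply: skeleton_iso => S.
by rewrite qS (product_skeleton m2 hme hv).
Qed.
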